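(* Let $r,k$ be positive integers and let $n\ge2r$ be an integer. The algebra $\mathrm{MP}_{r,k}(n)$ is generated by the set $$\Theta=\{P_{i,j,\boldsymbol{a}}:i,j\in[k],\ \boldsymbol{a}\in W_{r-1,k}\}\cup\{R_{\boldsymbol{a},\boldsymbol{b},\boldsymbol{c}}:\boldsymbol{a},\boldsymbol{b}\in W_{i,k},\ \boldsymbol{c}\in W_{r-i,k}\text{ for some }i\in[r]\}.$$
   Context: $[r]=\{1,\dots,r\}$, $[\bar r]=\{\bar1,\dots,\bar r\}$; $\Pi_{2(r)}$ is the set of set partitions of $[r]\cup[\bar r]$, drawn as diagrams with top row $1,\dots,r$ and bottom row $\bar1,\dots,\bar r$. The partition algebra $P_r(n)$ is the $\mathbb{C}$-algebra with basis $\{\mathcal{L}_\pi:\pi\in\Pi_{2(r)}\}$ and product $\mathcal{L}_\pi\mathcal{L}_\nu=n^{c}\mathcal{L}_\gamma$: place $\pi$ above $\nu$, identify bottom vertex $\bar i$ of $\pi$ with top vertex $i$ of $\nu$; $\gamma$ is the resulting connectivity of the very top and very bottom rows and $c$ the number of components entirely in the middle. For $\sigma\in\mathfrak{S}_r$, $\mathcal{L}_\sigma$ is the basis element of $\{\{\sigma(1),\bar1\},\dots,\{\sigma(r),\bar r\}\}$. $W_{s,k}$ is the set of sequences of $k$ non-negative integers with sum $s$. For $\boldsymbol{a}\in W_{r,k}$, $\mathfrak{S}_{\boldsymbol{a}}\subseteq\mathfrak{S}_r$ is the Young subgroup permuting separately the consecutive intervals of lengths $\boldsymbol{a}_1,\dots,\boldsymbol{a}_k$,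 and $s_{\boldsymbol{a}}=\frac1{|\mathfrak{S}_{\boldsymbol{a}}|}\sum_{\sigma\in\mathfrak{S}_{\boldsymbol{a}}}\mathcal{L}_\sigma$. For $n\ge2r$, the multiset partition algebra $\mathrm{MP}_{r,k}(n)\cong\mathrm{End}_{\mathfrak{S}_n}(\mathcal{P}^r(V_{n,k}))$ (homogeneous degree-$r$ polynomial functions on $n\times k$ complex matrices, permutation matrices acting by $(M.f)(X)=f(M^{-1}X)$) is identified with the painted algebra $\bigoplus_{\boldsymbol{a},\boldsymbol{b}\in W_{r,k}}s_{\boldsymbol{a}}P_r(n)s_{\boldsymbol{b}}$ (external direct sum) with product $(s_{\boldsymbol{a}}\varphi s_{\boldsymbol{b}})\cdot(s_{\boldsymbol{c}}\psi s_{\boldsymbol{d}})=\delta_{\boldsymbol{b},\boldsymbol{c}}s_{\boldsymbol{a}}\varphi s_{\boldsymbol{b}}\psi s_{\boldsymbol{d}}$. $\tilde\Pi_{2(r),k}$ is the set of multiset partitions (multisets of nonempty multisets, called blocks) with $r$ elements from $[k]$ and $r$ elements from $[\bar k]$ in total. $\kappa_{\boldsymbol{a},\boldsymbol{b}}:\Pi_{2(r)}\to\tilde\Pi_{2(r),k}$ replaces each unbarred $i$ by the index $j$ of the consecutive interval of lengths $\boldsymbol{a}_1,\dots,\boldsymbol{a}_k$ containing $i$, and each $\bar i$ by $\bar j$ with $j$ the index of the interval of lengths $\boldsymbol{b}_1,\dots,\boldsymbol{b}_k$ containing $i$. If $\tilde\pi\in\tilde\Pi_{2(r),k}$ has unbarred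 multiplicities $\boldsymbol{a}$ and barred multiplicities $\boldsymbol{b}$, then $\mathcal{D}_{\tilde\pi}=s_{\boldsymbol{a}}\mathcal{L}_\pi s_{\boldsymbol{b}}$ for any $\pi$ with $\kappa_{\boldsymbol{a},\boldsymbol{b}}(\pi)=\tilde\pi$; these form the diagram-like basis of $\mathrm{MP}_{r,k}(n)$. For $i,j\in[k]$ and $\boldsymbol{a}\in W_{r-1,k}$, $P_{i,j,\boldsymbol{a}}=\mathcal{D}_{\tilde\pi}$ where $\tilde\pi$ consists of the singleton blocks $\{i\}$ and $\{\bar j\}$ together with $\boldsymbol{a}_m$ copies of the block $\{m,\bar m\}$ (vertical bar) for each $m\in[k]$. For $i\in[r]$, $\boldsymbol{a},\boldsymbol{b}\in W_{i,k}$, $\boldsymbol{c}\in W_{r-i,k}$, $R_{\boldsymbol{a},\boldsymbol{b},\boldsymbol{c}}=\mathcal{D}_{\tilde\pi}$ where $\tilde\pi$ consists of one block containing each $m\in[k]$ with multiplicity $\boldsymbol{a}_m$ and each $\bar m$ with multiplicity $\boldsymbol{b}_m$, together with $\boldsymbol{c}_m$ copies of $\{m,\bar m\}$ for each $m\in[k]$. *)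

(* Defs.v *)
From HB Require Import structures.
From mathcomp Require Import all_boot all_order all_algebra all_fingroup.
From mathcomp Require Import finmap multiset.
From mathcomp Require Import boolp.

Set Implicit Arguments.
Unset Strict Implicit.
Unset Printing Implicit Defensive.

Import GRing.Theory Num.Theory.

Local Open Scope nat_scope.
Local Open Scope set_scope.

(* Set partitions of the top row (inl) and the bottom row (inr); the vertex   *)
(* called i + 1 in the mathematics is i : 'I_r.                               *)
Definition vertex (r : nat) : finType := ('I_r + 'I_r)%type.

Record diagram (r : nat) : predArgType := Diagram {
  blocks :> {set {set vertex r}};
  _ : partition blocks [set: vertex r]
}.
HB.instance Definition _ r := [isSub for @blocks r].
HB.instance Definition _ r := [Finite of diagram r by <:].

Section Stack.
Variable r : nat.
Implicit Types P Q : diagram r.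

(* Three rows: top, middle, bottom, in this order.                            *)
Definition stack : finType := ('I_r + 'I_r + 'I_r)%type.

Definition upper (v : vertex r) : stack := inl v.

Definition lower (v : vertex r) : stack :=
  match v with inl i => inl (inr i) | inr i => inr i end.

Definition outer (v : vertex r) : stack :=
  match v with inl i => inl (inl i) | inr i => inr i end.

Definition middle : {set stack} := [set inl (inr i) | i : 'I_r].

Definition same_block P : rel (vertex r) :=
  fun u v => pblock P u == pblock P v.

(* P is placed above Q.                                                       *)
Definition stack_rel P Q : rel stack := fun x y =>
     [exists u, exists v, [&& same_block P u v, x == upper u & y == upper v]]
  || [exists u, exists v, [&& same_block Q u v, x == lower u & y == lower v]].

Definition stack_components P Q : {set {set stack}} :=
  equivalence_partition (connect (stack_rel P Q)) [set: stack].

Definition nb_middle P Q : nat :=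
  #|[set C in stack_components P Q | C \subset middle]|.

Lemma same_block_equiv P : equivalence_rel (same_block P).
Proof.
by move=> u v w; split; [exact: eqxx | rewrite /same_block => /eqP ->].
Qed.

Lemma stack_rel_sym P Q : symmetric (stack_rel P Q).
Proof.
move=> x y; rewrite /stack_rel; congr (_ || _); apply/idP/idP;
move=> /existsP[u /existsP[v /and3P[/eqP h1 h2 h3]]];
by apply/existsP; exists v; apply/existsP; exists u; rewrite /same_block h1 eqxx h2 h3.
Qed.

Lemma connect_stack_equiv P Q : equivalence_rel (connect (stack_rel P Q)).
Proof.
have cs := sym_connect_sym (stack_rel_sym P Q).
move=> x y z; split => // cxy; apply/idP/idP => h.
  by apply: connect_trans h; rewrite cs.
exact: connect_trans h.
Qed.

Lemma outer_equiv P Q :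
  equivalence_rel [rel u v | connect (stack_rel P Q) (outer u) (outer v)].
Proof. by move=> u v w; have [] := connect_stack_equiv P Q (outer u) (outer v) (outer w). Qed.

Lemma compose_subproof P Q :
  partition (equivalence_partition
    [rel u v | connect (stack_rel P Q) (outer u) (outer v)] [set: vertex r])
    [set: vertex r].
Proof. by apply: equivalence_partitionP => ? ? ? _ _ _; apply: outer_equiv. Qed.

Definition compose P Q : diagram r := Diagram (compose_subproof P Q).

(* Two-colourings: the 0/1 matrix [mat P x z] tells whether the colouring x   *)
(* of the top row and z of the bottom row is constant on the blocks of P.     *)
(* Multiplicativity up to 2 ^ nb_middle gives the associativity below.        *)
Definition colouring : finType := {ffun 'I_r -> bool}.

Definition glue (x z : colouring) (v : vertex r) : bool :=
  match v with inl i => x i | inr i => z i end.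

Definition glue3 (x y z : colouring) (s : stack) : bool :=
  match s with inl (inl i) => x i | inl (inr i) => y i | inr i => z i end.

Definition compat P (f : vertex r -> bool) : bool :=
  [forall u, forall v, same_block P u v ==> (f u == f v)].

Definition mat P (x z : colouring) : nat := compat P (glue x z).

Lemma compatP P f :
  reflect (forall u v, same_block P u v -> f u = f v) (compat P f).
Proof.
apply: (iffP 'forall_'forall_implyP) => h u v /h; first by move/eqP.
by move->.
Qed.

Lemma glueE (f : vertex r -> bool) :
  exists x z, glue x z =1 f.
Proof.
exists [ffun i => f (inl i)], [ffun i => f (inr i)].
by case=> i; rewrite /= ffunE.
Qed.

Lemma same_compose P Q u v :
  same_block (compose P Q) u v = connect (stack_rel P Q) (outer u) (outer v).
Proof.
rewrite /same_block eq_pblock; last first.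
- by rewrite (cover_partition (valP (compose P Q))) inE.
- exact: partition_trivIset (valP (compose P Q)).
by rewrite pblock_equivalence_partition ?inE // => ? ? ? _ _ _; apply: outer_equiv.
Qed.

Lemma stack_relP P Q (f : stack -> bool) :
  reflect (forall s t, connect (stack_rel P Q) s t -> f s = f t)
    (compat P (f \o upper) && compat Q (f \o lower)).
Proof.
apply: (iffP andP) => [[/compatP hP /compatP hQ] s t|h]; last first.
  split; apply/compatP => u v uv; apply: h; apply: connect1; apply/orP.
    by left; apply/existsP; exists u; apply/existsP; exists v; rewrite uv !eqxx.
  by right; apply/existsP; exists u; apply/existsP; exists v; rewrite uv !eqxx.
case/connectP => p; elim: p s => [|w p IH] s /=; first by move=> _ ->.
case/andP => sw pw tl; rewrite -(IH w pw tl).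
case/orP: sw => /existsP[u /existsP[v /and3P[uv /eqP-> /eqP->]]].
  exact: hP uv.
exact: hQ uv.
Qed.

Lemma mat_compose P Q x z :
  \sum_y mat P x y * mat Q y z = 2 ^ nb_middle P Q * mat (compose P Q) x z.
Proof.
set Y := [set y | compat P (glue x y) && compat Q (glue y z)].
have -> : \sum_y mat P x y * mat Q y z = #|Y|.
  rewrite -sum1_card [RHS]big_mkcond; apply: eq_bigr => y _.
  by rewrite inE /mat; case: compat; case: compat.
have YP y : reflect (forall s t, connect (stack_rel P Q) s t ->
    glue3 x y z s = glue3 x y z t) (y \in Y).
  rewrite inE.
  have -> : compat P (glue x y) = compat P (glue3 x y z \o upper).
    by apply: eq_forallb => u; apply: eq_forallb => v; case: u; case: v.
  have -> : compat Q (glue y z) = compat Q (glue3 x y z \o lower).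
    by apply: eq_forallb => u; apply: eq_forallb => v; case: u; case: v.
  exact: stack_relP.
have outE y v : glue3 x y z (outer v) = glue x z v by case: v.
rewrite /mat; case: (boolP (compat _ _)) => [/compatP hc|hc]; last first.
  rewrite muln0; apply/eqP; rewrite cards_eq0; apply/eqP/setP => y.
  rewrite in_set0; apply: contraNF hc => /YP hy; apply/compatP => u v.
  by rewrite same_compose => /hy; rewrite !outE.
rewrite muln1.
set E := stack_components P Q; set M := [set C in E | C \subset middle].
have eqv : {in [set: stack] & &, equivalence_rel (connect (stack_rel P Q))}.
  by move=> ? ? ? _ _ _; apply: connect_stack_equiv.
have pE : partition E [set: stack] by apply: equivalence_partitionP.
have tE := partition_trivIset pE.
have cE s : s \in cover E by rewrite (cover_partition pE) inE.
have pbE s t : (t \in pblock E s) = connect (stack_rel P Q) s t.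
  by rewrite pblock_equivalence_partition ?inE.
have eqE s t : connect (stack_rel P Q) s t -> pblock E s = pblock E t.
  by rewrite -pbE => /same_pblock ->.
pose mid i : stack := inl (inr i).
pose h (S : {set {set stack}}) : colouring := [ffun i =>
  if pblock E (mid i) \in M then pblock E (mid i) \in S
  else [exists v, (outer v \in pblock E (mid i)) && glue x z v]].
have repr C : C \in M -> exists i, C = pblock E (mid i).
  rewrite inE => /andP[CE /subsetP Cm].
  have : C != set0 by apply: contraTneq CE => ->; case/and3P: pE.
  case/set0Pn => s sC; have /imsetP[i _ si] := Cm _ sC.
  by exists i; rewrite -/(mid i) /mid -si (def_pblock tE CE sC).
have <- : h @: powerset M = Y.
  apply/setP => y; apply/imsetP/YP => [[S SM ->] s t st|hy].
  - (* every component takes a constant value *)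
    pose g (C : {set stack}) : bool := if C \in M then C \in S
      else [exists v, (outer v \in C) && glue x z v].
    suff gE w : glue3 x (h S) z w = g (pblock E w) by rewrite !gE (eqE _ _ st).
    have gout v : glue x z v = g (pblock E (outer v)).
      rewrite /g ifF; last first.
        rewrite inE; apply/negbTE/negP => /andP[_ /subsetP/(_ (outer v))].
        rewrite mem_pblock cE => /(_ isT) /imsetP[i _].
        by case: v.
      apply/idP/existsP => [gv|[u /andP[]]].
        by exists v; rewrite mem_pblock cE.
      by rewrite pbE -same_compose => /hc ->.
    case: w => [[i|i]|i] /=.
    + exact: (gout (inl i)).
    + by rewrite ffunE.
    + exact: (gout (inr i)).
  - exists [set C in M | [exists i, (C == pblock E (mid i)) && y i]].
      by rewrite powersetE; apply/subsetP => C; rewrite inE => /andP[].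
    apply/ffunP => i; rewrite ffunE; case: ifPn => [iM|iM].
      rewrite inE iM /=; apply/idP/existsP => [yi|[j /andP[/eqP ij yj]]].
        by exists i; rewrite eqxx.
      have : connect (stack_rel P Q) (mid i) (mid j).
        by rewrite -pbE ij mem_pblock cE.
      by move/hy => /= ->.
    have [v vi] : exists v, outer v \in pblock E (mid i).
      move: iM; rewrite inE pblock_mem ?cE //= => /subsetPn[s sE sm].
      case: s sE sm => [[j|j]|j] sE sm; first by exists (inl j).
        by case/imsetP: sm; exists j.
      by exists (inr j).
    apply/idP/existsP => [yi|[u /andP[]]].
      by exists v; rewrite vi -(outE y); move: vi; rewrite pbE => /hy <-.
    by rewrite pbE -(outE y) => /hy /= ->.
rewrite card_in_imset ?card_powerset // => S T; rewrite !powersetE.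
move=> /subsetP SM /subsetP TM /ffunP hST; apply/setP => C.
have [CM|CM] := boolP (C \in M); last first.
  by rewrite (contraNF (SM C) CM) (contraNF (TM C) CM).
have [i Ci] := repr _ CM.
by move: (hST i); rewrite !ffunE -Ci CM.
Qed.

Lemma diagram_eq P Q : same_block P =2 same_block Q -> P = Q.
Proof.
move=> h; apply: val_inj; apply/setP => B.
suff mem_val (X : diagram r) : (B \in val X) =
    [exists u, B == [set v | same_block X u v]].
  rewrite !mem_val; apply: eq_existsb => u; congr (_ == _).
  by apply/setP => v; rewrite !inE h.
have pX := valP X; have tX := partition_trivIset pX.
have cX u : u \in cover X by rewrite (cover_partition pX) inE.
have bE u : [set v | same_block X u v] = pblock X u.
  by apply/setP => v; rewrite inE /same_block eq_pblock ?cX.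
apply/idP/existsP => [BX|[u /eqP->]]; last by rewrite bE pblock_mem.
have : B != set0 by apply: contraTneq BX => ->; case/and3P: pX.
by case/set0Pn => u uB; exists u; rewrite bE (def_pblock tX BX uB).
Qed.

Lemma mat_inj P Q c d :
  (forall x z, 2 ^ c * mat P x z = 2 ^ d * mat Q x z) -> c = d /\ P = Q.
Proof.
move=> h.
have m1 X : mat X [ffun=> true] [ffun=> true] = 1.
  rewrite /mat; case: compatP => // -[] u v _.
  by case: u; case: v => ? ?; rewrite /= !ffunE.
have cd : c = d.
  by move: (h [ffun=> true] [ffun=> true]); rewrite !m1 !muln1 => /expnI ->.
split=> //; subst d.
have {}h x z : compat P (glue x z) = compat Q (glue x z).
  move: (h x z) => /eqP; rewrite eqn_mul2l expn_eq0 /= /mat.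
  by case: compat; case: compat.
have {}h f : compat P f = compat Q f.
  have [x [z fE]] := glueE f; have := h x z.
  have cE X : compat X (glue x z) = compat X f.
    by apply: eq_forallb => u; apply: eq_forallb => v; rewrite !fE.
  by rewrite !cE.
apply: diagram_eq => u v.
have gen X Z : (forall f, compat X f = compat Z f) -> same_block X u v -> same_block Z u v.
  move=> hXZ; have : compat Z (same_block Z u).
    by apply/compatP => w t; rewrite /same_block => /eqP ->.
  by rewrite -hXZ => /compatP H /H <-; rewrite /same_block eqxx.
by apply/idP/idP; apply: gen.
Qed.

Lemma mat_assoc (mP mQ mX mQX mPQ mA mB : colouring -> colouring -> nat)
    (a b c d : nat) (x z : colouring) :
  (forall x z, \sum_y mQ x y * mX y z = 2 ^ a * mQX x z) ->
  (forall x z, \sum_y mP x y * mQX y z = 2 ^ b * mA x z) ->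
  (forall x z, \sum_y mP x y * mQ y z = 2 ^ c * mPQ x z) ->
  (forall x z, \sum_y mPQ x y * mX y z = 2 ^ d * mB x z) ->
  2 ^ (a + b) * mA x z = 2 ^ (c + d) * mB x z.
Proof.
move=> hQX hA hPQ hB; rewrite !expnD -!mulnA -hA -hB !big_distrr /=.
transitivity (\sum_y \sum_w mP x y * (mQ y w * mX w z)).
  by apply: eq_bigr => y _; rewrite mulnCA -hQX big_distrr.
rewrite exchange_big; apply: eq_bigr => w _; rewrite mulnA -hPQ big_distrl.
by apply: eq_bigr => y _; rewrite mulnA.
Qed.

Lemma composeA P Q X :
  compose P (compose Q X) = compose (compose P Q) X /\
  nb_middle Q X + nb_middle P (compose Q X) =
  nb_middle P Q + nb_middle (compose P Q) X.
Proof.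
suff: nb_middle Q X + nb_middle P (compose Q X) =
  nb_middle P Q + nb_middle (compose P Q) X
  /\ compose P (compose Q X) = compose (compose P Q) X.
  by move=> [h1 h2]; exact: (conj h2 h1).
by apply: mat_inj => x z; apply: mat_assoc; apply: mat_compose.
Qed.

Section PermDiagram.
Variable s : {perm 'I_r}.

Definition perm_blocks : {set {set vertex r}} :=
  [set [set inl (s i); inr i] | i : 'I_r].

Let lab (v : vertex r) : 'I_r := match v with inl i => i | inr i => s i end.

Let perm_blocksE : perm_blocks = preim_partition lab [set: vertex r].
Proof.
have bE u : [set v in [set: vertex r] | lab u == lab v] =
    [set inl (lab u); inr (s^-1%g (lab u))].
  apply/setP => -[v|v]; rewrite !inE /= ?orbF /=; first exact: eq_sym.
  by apply/eqP/eqP => [->|[->]]; rewrite ?permK ?permKV.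
apply/setP => B; apply/imsetP/imsetP => [[i _ ->]|[u _ ->]].
  by exists (inr i) => //; rewrite bE /= permK.
by exists (s^-1%g (lab u)) => //; rewrite bE permKV.
Qed.

Lemma perm_blocks_partition : partition perm_blocks [set: vertex r].
Proof. by rewrite perm_blocksE preim_partitionP. Qed.

Definition perm_diagram : diagram r := Diagram perm_blocks_partition.

Lemma mat_perm x z : mat perm_diagram x z = (z == [ffun i => x (s i)]).
Proof.
have sE u v : same_block perm_diagram u v = (lab u == lab v).
  rewrite /same_block eq_pblock ?(partition_trivIset perm_blocks_partition) //.
    rewrite /= perm_blocksE pblock_equivalence_partition ?inE //.
    by move=> a b c _ _ _; split=> //= /eqP ->.
  by rewrite (cover_partition perm_blocks_partition) inE.
congr nat_of_bool; apply/compatP/eqP => [h|-> u v].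
  apply/ffunP => i; rewrite ffunE.
  by have /= -> // := h (inl (s i)) (inr i); rewrite sE.
by rewrite sE; case: u; case: v => i j /= /eqP; rewrite ?ffunE; first [move=> -> | move=> <-].
Qed.

End PermDiagram.

Lemma compose_perm (s t : {perm 'I_r}) :
  compose (perm_diagram s) (perm_diagram t) = perm_diagram (t * s)%g /\
  nb_middle (perm_diagram s) (perm_diagram t) = 0.
Proof.
suff: nb_middle (perm_diagram s) (perm_diagram t) = 0 /\
  compose (perm_diagram s) (perm_diagram t) = perm_diagram (t * s)%g by move=> [h1 h2]; exact: (conj h2 h1).
apply: mat_inj => x z; rewrite -mat_compose mul1n !mat_perm.
rewrite (bigD1 [ffun i => x (s i)]) //= big1 ?addn0 => [|y /negPf yE]; last first.
  by rewrite !mat_perm yE.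
rewrite !mat_perm eqxx mul1n; congr (nat_of_bool (_ == _)).
by apply/ffunP => i; rewrite !ffunE permM.
Qed.

Lemma compose1l P :
  compose (perm_diagram 1) P = P /\ nb_middle (perm_diagram 1) P = 0.
Proof.
suff: nb_middle (perm_diagram 1) P = 0 /\ compose (perm_diagram 1) P = P by move=> [h1 h2]; exact: (conj h2 h1).
apply: mat_inj => x z; rewrite -mat_compose mul1n.
have x1 : [ffun i => x ((1%g : {perm 'I_r}) i)] = x.
  by apply/ffunP => i; rewrite ffunE perm1.
rewrite (bigD1 x) //= big1 ?addn0 => [|y /negPf yE]; rewrite mat_perm x1.
  by rewrite eqxx mul1n.
by rewrite yE.
Qed.

Lemma compose1r P :
  compose P (perm_diagram 1) = P /\ nb_middle P (perm_diagram 1) = 0.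
Proof.
suff: nb_middle P (perm_diagram 1) = 0 /\ compose P (perm_diagram 1) = P by move=> [h1 h2]; exact: (conj h2 h1).
apply: mat_inj => x z; rewrite -mat_compose mul1n.
have y1 (y : colouring) : [ffun i => y ((1%g : {perm 'I_r}) i)] = y.
  by apply/ffunP => i; rewrite ffunE perm1.
rewrite (bigD1 z) //= big1 ?addn0 => [|y /negPf yE]; rewrite mat_perm y1.
  by rewrite eqxx muln1.
by rewrite eq_sym yE muln0.
Qed.

End Stack.

Local Open Scope ring_scope.

Definition partalg (K : fieldType) (r n : nat) : Type :=
  {ffun diagram r -> K^o}.

Section PartitionAlgebra.
Variables (K : fieldType) (r n : nat).
Local Notation A := (partalg K r n).

HB.instance Definition _ := GRing.Lmodule.copy A {ffun diagram r -> K^o}.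
HB.instance Definition _ := Vector.copy A {ffun diagram r -> K^o}.

Definition dbasis (P : diagram r) : A := [ffun Q => (Q == P)%:R].

Definition partalg_mul (x y : A) : A :=
  \sum_P \sum_Q (x P * y Q * n%:R ^+ nb_middle P Q) *: dbasis (compose P Q).

Lemma partalgE (x : A) : x = \sum_P x P *: dbasis P.
Proof.
apply/ffunP => Q; rewrite sum_ffunE (bigD1 Q) //= big1 ?addr0.
  by rewrite !ffunE eqxx; exact: esym (mulr1 _).
by move=> P PQ; rewrite !ffunE eq_sym (negPf PQ); exact: mulr0.
Qed.

Fact partalg_mulDl : left_distributive partalg_mul +%R.
Proof.
move=> x y z; rewrite /partalg_mul -big_split; apply: eq_bigr => P _ /=.
rewrite -big_split; apply: eq_bigr => Q _ /=.
by rewrite -scalerDl ffunE !mulrDl.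
Qed.

Fact partalg_mulDr : right_distributive partalg_mul +%R.
Proof.
move=> x y z; rewrite /partalg_mul -big_split; apply: eq_bigr => P _ /=.
rewrite -big_split; apply: eq_bigr => Q _ /=.
by rewrite -scalerDl ffunE mulrDr !mulrDl.
Qed.

Fact partalg_scaleAl a (x y : A) :
  a *: partalg_mul x y = partalg_mul (a *: x) y.
Proof.
rewrite /partalg_mul scaler_sumr; apply: eq_bigr => P _.
rewrite scaler_sumr; apply: eq_bigr => Q _.
by rewrite scalerA ffunE; congr (_ *: _); rewrite !mulrA.
Qed.

Fact partalg_scaleAr a (x y : A) :
  a *: partalg_mul x y = partalg_mul x (a *: y).
Proof.
rewrite /partalg_mul scaler_sumr; apply: eq_bigr => P _.
rewrite scaler_sumr; apply: eq_bigr => Q _.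
rewrite scalerA ffunE; congr (_ *: _).
by rewrite -[a *: y Q]/(a * y Q : K) [in RHS]mulrCA !mulrA.
Qed.

Lemma partalg_mulLL P Q : partalg_mul (dbasis P) (dbasis Q) =
  n%:R ^+ nb_middle P Q *: dbasis (compose P Q).
Proof.
rewrite /partalg_mul (bigD1 P) //= [X in _ + X]big1 ?addr0; last first.
  move=> P' /negPf nP; rewrite big1 // => Q' _.
  by rewrite ffunE nP !mul0r scale0r.
rewrite (bigD1 Q) //= [X in _ + X]big1 ?addr0; last first.
  by move=> Q' /negPf nQ; rewrite [dbasis Q Q']ffunE nQ mulr0 mul0r scale0r.
by rewrite !ffunE !eqxx mulr1 mul1r.
Qed.

Let lin (f : A -> A) :=
  {morph f : u v / u + v} /\ (forall t, {morph f : u / t *: u}).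

Let lin_mull x : lin (partalg_mul x).
Proof.
by split=> [u v|t u]; [exact: partalg_mulDr | exact/esym/partalg_scaleAr].
Qed.

Let lin_mulr y : lin (partalg_mul^~ y).
Proof.
by split=> [u v|t u]; [exact: partalg_mulDl | exact/esym/partalg_scaleAl].
Qed.

Let lin_comp f g : lin f -> lin g -> lin (f \o g).
Proof.
by move=> [fD fZ] [gD gZ]; split=> [u v|t u] /=; [rewrite gD fD | rewrite gZ fZ].
Qed.

Let lin_ext f g :
  lin f -> lin g -> (forall P, f (dbasis P) = g (dbasis P)) -> f =1 g.
Proof.
move=> [fD fZ] [gD gZ] fg x; rewrite (partalgE x).
have f0 : f 0 = 0 by rewrite -{1}(scale0r 0) fZ scale0r.
have g0 : g 0 = 0 by rewrite -{1}(scale0r 0) gZ scale0r.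
rewrite (big_morph f fD f0) (big_morph g gD g0).
by apply: eq_bigr => P _; rewrite fZ gZ fg.
Qed.

Fact partalg_mulA : associative partalg_mul.
Proof.
have aux (a b c d : nat) (u v : A) : u = v -> (a + b = c + d)%N ->
    n%:R ^+ a *: (n%:R ^+ b *: u) = n%:R ^+ c *: (n%:R ^+ d *: v) :> A.
  by move=> -> e; rewrite !scalerA -!exprD e.
move=> x y z.
apply: (@lin_ext (partalg_mul^~ (partalg_mul y z))
  (partalg_mul^~ z \o partalg_mul^~ y)) => [||P] /=.
- exact: lin_mulr.
- by apply: lin_comp; apply: lin_mulr.
apply: (@lin_ext (partalg_mul (dbasis P) \o partalg_mul^~ z)
  (partalg_mul^~ z \o partalg_mul (dbasis P))) => [||Q] /=.
- by apply: lin_comp; [apply: lin_mull | apply: lin_mulr].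
- by apply: lin_comp; [apply: lin_mulr | apply: lin_mull].
apply: (@lin_ext (partalg_mul (dbasis P) \o partalg_mul (dbasis Q))
  (partalg_mul (partalg_mul (dbasis P) (dbasis Q)))) => [||X] /=.
- by apply: lin_comp; apply: lin_mull.
- exact: lin_mull.
rewrite (partalg_mulLL Q X) (partalg_mulLL P Q).
rewrite -partalg_scaleAl -partalg_scaleAr.
rewrite (partalg_mulLL P) (partalg_mulLL (compose P Q)).
have [eC eN] := composeA P Q X.
by apply: aux; [rewrite eC | exact: eN].
Qed.

Fact partalg_mul1r : left_id (dbasis (perm_diagram 1)) partalg_mul.
Proof.
apply: (@lin_ext _ id) => // P; rewrite partalg_mulLL.
by have [-> ->] := compose1l P; rewrite expr0 scale1r.
Qed.

Fact partalg_mulr1 : right_id (dbasis (perm_diagram 1)) partalg_mul.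
Proof.
apply: (@lin_ext (partalg_mul^~ _) id) => // P; rewrite partalg_mulLL.
by have [-> ->] := compose1r P; rewrite expr0 scale1r.
Qed.

Fact partalg_1neq0 : dbasis (perm_diagram 1) != 0.
Proof.
apply/eqP => /ffunP/(_ (perm_diagram 1)); rewrite !ffunE eqxx => /eqP.
by rewrite oner_eq0.
Qed.

HB.instance Definition _ := GRing.Zmodule_isNzRing.Build A partalg_mulA
  partalg_mul1r partalg_mulr1 partalg_mulDl partalg_mulDr partalg_1neq0.
HB.instance Definition _ := GRing.Lmodule_isLalgebra.Build K A partalg_scaleAl.
HB.instance Definition _ := GRing.Lalgebra_isAlgebra.Build K A partalg_scaleAr.

Lemma dbasisM P Q : dbasis P * dbasis Q =
  n%:R ^+ nb_middle P Q *: dbasis (compose P Q).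
Proof. exact: partalg_mulLL. Qed.

Lemma dbasis_perm (s t : 'S_r) :
  dbasis (perm_diagram s) * dbasis (perm_diagram t) =
  dbasis (perm_diagram (t * s)%g).
Proof.
rewrite dbasisM; have [-> ->] := compose_perm s t.
by rewrite expr0 scale1r.
Qed.

End PartitionAlgebra.

(* The entries are stored as ordinals bounded by the sum s, so that W_(s,k)   *)
(* is a finite type.                                                          *)
Record wcomp (s k : nat) : predArgType := WComp {
  wtuple : k.-tuple 'I_s.+1;
  _ : sumn (map val wtuple) == s
}.
HB.instance Definition _ s k := [isSub for @wtuple s k].
HB.instance Definition _ s k := [Finite of wcomp s k by <:].

Definition wfun s k (a : wcomp s k) : 'I_k -> nat := fun j => tnth (wtuple a) j.
Coercion wfun : wcomp >-> Funclass.

Lemma sum_wcomp s k (a : wcomp s k) : (\sum_j a j)%N = s.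
Proof.
rewrite -[RHS](eqP (valP a)) sumnE big_map -[X in _ = \sum_(i <- X) _]/(tval _).
by rewrite big_tuple.
Qed.

Section WCompOf.
Variables (s k : nat) (f : 'I_k -> nat) (fs : (\sum_j f j)%N = s).

Lemma wcomp_of_subproof :
  sumn (map val [tuple inord (f j) : 'I_s.+1 | j < k]) == s.
Proof.
rewrite sumnE big_map big_tuple -[X in _ == X]fs; apply/eqP.
apply: eq_bigr => j _; rewrite tnth_mktuple /= inordK // ltnS -[X in (_ <= X)%N]fs.
by rewrite (bigD1 j) //= leq_addr.
Qed.

Definition wcomp_of : wcomp s k := WComp wcomp_of_subproof.

Lemma wcomp_ofE j : wcomp_of j = f j.
Proof.
rewrite /wfun tnth_mktuple inordK // ltnS -[X in (_ <= X)%N]fs.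
by rewrite (bigD1 j) //= leq_addr.
Qed.

End WCompOf.

Section Painted.
Variables (r k : nat).
Implicit Types (a b c d : wcomp r k) (i : 'I_r).

Lemma interval_subproof a i :
  (reshape_index (map val (wtuple a)) i < k)%N.
Proof.
have := @reshape_indexP (map val (wtuple a)) i.
by rewrite (eqP (valP a)) size_map size_tuple; apply.
Qed.

(* [reshape_index] cuts 0, 1, ... into consecutive intervals of the given     *)
(* lengths and returns the position of the interval containing i.             *)
Definition interval a i : 'I_k := Ordinal (interval_subproof a i).

Definition young a : {set 'S_r} :=
  [set s : 'S_r | [forall i, interval a (s i) == interval a i]].

Lemma young_group_set a : group_set (young a).
Proof.
apply/group_setP; split=> [|s t]; rewrite !inE.
  by apply/forallP => i; rewrite perm1.
move=> /forallP hs /forallP ht; apply/forallP => i.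
by rewrite permM (eqP (ht _)) hs.
Qed.
Canonical young_group a := Group (young_group_set a).

Variables (K : numFieldType) (n : nat).
Local Notation A := (partalg K r n).

Definition symm a : A :=
  #|young a|%:R^-1 *: \sum_(s in young a) dbasis K n (perm_diagram s).

Lemma symm_idem a : symm a * symm a = symm a.
Proof.
have cardK : #|young a|%:R != 0 :> K.
  by rewrite pnatr_eq0 -lt0n cardG_gt0.
rewrite {1}/symm -scalerAl mulr_suml.
transitivity (#|young a|%:R^-1 *: \sum_(s in young a) symm a); last first.
  by rewrite sumr_const -scaler_nat scalerA mulVf // scale1r.
congr (_ *: _); apply: eq_bigr => s ys.
rewrite /symm -scalerAr mulr_sumr; congr (_ *: _).
rewrite [RHS](reindex_inj (mulIg s)) /=.
apply: eq_big => [t|t _]; first by rewrite (groupMr _ ys).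
by rewrite dbasis_perm.
Qed.

Lemma symm_neq0 a : symm a != 0.
Proof.
have cardK : #|young a|%:R != 0 :> K.
  by rewrite pnatr_eq0 -lt0n cardG_gt0.
have pinj (s t : 'S_r) : perm_diagram s = perm_diagram t -> s = t.
  move=> st; apply/permP => i; apply/eqP.
  pose x : colouring r := [ffun j => j == s i].
  have := mat_perm s x [ffun j => x (s j)].
  rewrite st mat_perm eqxx => /eqP; rewrite eqb1 => /eqP/ffunP/(_ i).
  by rewrite !ffunE eqxx => /esym; rewrite eq_sym.
rewrite scaler_eq0 invr_eq0 negb_or cardK /=.
apply/eqP => /ffunP/(_ (perm_diagram 1)); rewrite sum_ffunE (bigD1 1%g) //=.
rewrite big1 => [|s /andP[_ s1]]; last first.
  by rewrite ffunE; case: eqP => // /pinj s1'; rewrite -s1' eqxx in s1.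
by rewrite !ffunE eqxx addr0 => /eqP; rewrite oner_eq0.
Qed.

Definition corner a b : {pred A} :=
  [pred x | `[< exists phi : A, x = symm a * phi * symm b >]].

Lemma cornerP a b (x : A) :
  reflect (exists phi : A, x = symm a * phi * symm b) (x \in corner a b).
Proof. exact: asboolP. Qed.

Lemma corner_in a b phi : symm a * phi * symm b \in corner a b.
Proof. by apply/cornerP; exists phi. Qed.

Lemma cornerM a b c x y :
  x \in corner a b -> y \in corner b c -> x * y \in corner a c.
Proof.
move=> /cornerP[f ->] /cornerP[g ->]; apply/cornerP.
by exists (f * symm b * symm b * g); rewrite !mulrA.
Qed.

Lemma corner_submod a b : submod_closed (corner a b).
Proof.
split=> [|t x y /cornerP[f ->] /cornerP[g ->]].
  by apply/cornerP; exists 0; rewrite mulr0 mul0r.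
apply/cornerP; exists (t *: f + g).
by rewrite mulrDr mulrDl -(scalerAr t (symm a) f) -(scalerAl t (symm a * f)).
Qed.

Lemma corner_mull a b x : x \in corner a b -> symm a * x = x.
Proof. by move=> /cornerP[f ->]; rewrite !mulrA symm_idem. Qed.

Lemma corner_mulr a b x : x \in corner a b -> x * symm b = x.
Proof. by move=> /cornerP[f ->]; rewrite -mulrA symm_idem. Qed.

Definition painted : {pred {ffun wcomp r k * wcomp r k -> A}} :=
  [pred x : {ffun wcomp r k * wcomp r k -> A} |
     [forall ab, x ab \in corner ab.1 ab.2]].

Fact painted_submod : submod_closed painted.
Proof.
split=> [|t x y /forallP hx /forallP hy]; apply/forallP => ab; rewrite !ffunE.
  by case: (corner_submod ab.1 ab.2).
by case: (corner_submod ab.1 ab.2) => _; apply.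
Qed.
HB.instance Definition _ := GRing.isSubmodClosed.Build K _ painted painted_submod.

End Painted.

(* MP_(r,k)(n) as the external direct sum of the s_a P_r(n) s_b. The          *)
(* hypothesis 0 < k only serves to make the algebra nonzero, as MathComp      *)
(* requires of its algebras.                                                  *)
Record MP (K : numFieldType) (r k n : nat) (k_gt0 : (0 < k)%N) :
    predArgType := MPElt {
  mpval : {ffun wcomp r k * wcomp r k -> partalg K r n};
  _ : mpval \in @painted r k K n
}.

Section MPAlgebra.
Variables (K : numFieldType) (r k n : nat) (k_gt0 : (0 < k)%N).
Local Notation A := (partalg K r n).
Local Notation mp := (@MP K r k n k_gt0).
Implicit Types (a b c d : wcomp r k) (x y z : mp).

HB.instance Definition _ := [isSub for @mpval K r k n k_gt0].
HB.instance Definition _ := [Choice of mp by <:].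
HB.instance Definition _ := [SubChoice_isSubLmodule of mp by <:].

Lemma mpP x a b : mpval x (a, b) \in corner a b.
Proof. by have /forallP/(_ (a, b)) := valP x. Qed.

Lemma mp_eq x y : (forall a b, mpval x (a, b) = mpval y (a, b)) -> x = y.
Proof. by move=> h; apply/val_inj/ffunP => -[a b]; apply: h. Qed.

Lemma mp_subproof (f : wcomp r k -> wcomp r k -> A) :
  (forall a b, f a b \in corner a b) ->
  [ffun ab => f ab.1 ab.2] \in @painted r k K n.
Proof. by move=> h; apply/forallP => -[a b]; rewrite ffunE. Qed.

Fact mp_one_subproof a b :
  (if a == b then symm K n a else 0) \in corner a b.
Proof.
case: eqP => [<-|_]; apply/cornerP; last by exists 0; rewrite mulr0 mul0r.
by exists 1; rewrite mulr1 symm_idem.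
Qed.

Definition mp_one : mp := MPElt k_gt0 (mp_subproof mp_one_subproof).

Fact mp_mul_subproof x y a d :
  \sum_b mpval x (a, b) * mpval y (b, d) \in corner a d.
Proof.
have [c0 cD] := corner_submod K n a d.
apply: (big_ind (fun u => u \in corner a d)) => // [u v hu hv|b _].
  by rewrite -[u]scale1r cD.
by apply: cornerM; apply: mpP.
Qed.

Definition mp_mul x y : mp := MPElt k_gt0 (mp_subproof (mp_mul_subproof x y)).

Let mp_mulE x y a d :
  mpval (mp_mul x y) (a, d) = \sum_b mpval x (a, b) * mpval y (b, d).
Proof. by rewrite ffunE. Qed.

Let mp_addE x y a b : mpval (x + y) (a, b) = mpval x (a, b) + mpval y (a, b).
Proof. by rewrite -[mpval _]/(val (x + y)) raddfD ffunE. Qed.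

Let mp_scaleE (t : K) x a b : mpval (t *: x) (a, b) = t *: mpval x (a, b).
Proof. by rewrite -[mpval _]/(val (t *: x)) linearZ ffunE. Qed.

Fact mp_mulA : associative mp_mul.
Proof.
move=> x y z; apply: mp_eq => a d; rewrite !mp_mulE.
under eq_bigr => b _ do rewrite mp_mulE mulr_sumr.
rewrite exchange_big; apply: eq_bigr => c _.
by rewrite mp_mulE mulr_suml; apply: eq_bigr => b _; rewrite mulrA.
Qed.

Fact mp_mul1r : left_id mp_one mp_mul.
Proof.
move=> x; apply: mp_eq => a d; rewrite mp_mulE (bigD1 a) //= big1 ?addr0.
  by rewrite ffunE eqxx (corner_mull (mpP x a d)).
by move=> b /negPf ba; rewrite ffunE /= eq_sym ba mul0r.
Qed.

Fact mp_mulr1 : right_id mp_one mp_mul.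
Proof.
move=> x; apply: mp_eq => a d; rewrite mp_mulE (bigD1 d) //= big1 ?addr0.
  by rewrite ffunE eqxx (corner_mulr (mpP x a d)).
by move=> b /negPf bd; rewrite ffunE /= bd mulr0.
Qed.

Fact mp_mulDl : left_distributive mp_mul +%R.
Proof.
move=> x y z; apply: mp_eq => a d; rewrite mp_addE !mp_mulE -big_split.
by apply: eq_bigr => b _; rewrite mp_addE mulrDl.
Qed.

Fact mp_mulDr : right_distributive mp_mul +%R.
Proof.
move=> x y z; apply: mp_eq => a d; rewrite mp_addE !mp_mulE -big_split.
by apply: eq_bigr => b _; rewrite mp_addE mulrDr.
Qed.

Fact mp_1neq0 : mp_one != 0.
Proof.
have fs : (\sum_(j < k) (if j == Ordinal k_gt0 then r else 0))%N = r.
  by rewrite -big_mkcond big_pred1_eq.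
pose a := wcomp_of fs.
apply/eqP => /(congr1 val); rewrite raddf0 => /ffunP/(_ (a, a)).
by rewrite !ffunE eqxx; apply/eqP/symm_neq0.
Qed.

HB.instance Definition _ := GRing.Zmodule_isNzRing.Build mp mp_mulA
  mp_mul1r mp_mulr1 mp_mulDl mp_mulDr mp_1neq0.

Fact mp_scaleAl (t : K) x y : t *: (x * y) = t *: x * y.
Proof.
apply: mp_eq => a d; rewrite mp_scaleE !mp_mulE scaler_sumr.
by apply: eq_bigr => b _; rewrite mp_scaleE scalerAl.
Qed.
HB.instance Definition _ := GRing.Lmodule_isLalgebra.Build K mp mp_scaleAl.

Fact mp_scaleAr (t : K) x y : t *: (x * y) = x * (t *: y).
Proof.
apply: mp_eq => a d; rewrite mp_scaleE !mp_mulE scaler_sumr.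
by apply: eq_bigr => b _; rewrite mp_scaleE scalerAr.
Qed.
HB.instance Definition _ := GRing.Lalgebra_isAlgebra.Build K mp mp_scaleAr.

Fact mp_single_subproof a b (phi : A) c d :
  (if (c, d) == (a, b) then symm K n a * phi * symm K n b else 0)
    \in corner c d.
Proof.
case: eqP => [[-> ->]|_]; first exact: corner_in.
by case: (corner_submod K n c d).
Qed.

(* s_a phi s_b in the summand indexed by (a, b).                              *)
Definition mp_single a b (phi : A) : mp :=
  MPElt k_gt0 (mp_subproof (mp_single_subproof a b phi)).

Lemma mp_singleM a b c d (phi psi : A) :
  mp_single a b phi * mp_single c d psi =
  if b == c then mp_single a d (phi * symm K n b * psi) else 0.
Proof.
apply: mp_eq => a' d'; rewrite mp_mulE; case: eqP => [<-|bc].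
  rewrite ffunE /= xpair_eqE (bigD1 b) //= big1 ?addr0 => [|b' /negPf bb].
    rewrite !ffunE /= !xpair_eqE eqxx andbT.
    case: eqP => _; last by rewrite mul0r.
    case: eqP => _; last by rewrite mulr0.
    by rewrite !mulrA -(mulrA _ _ (symm K n b)) symm_idem.
  by rewrite !ffunE /= !xpair_eqE bb andbF mul0r.
rewrite -[mpval 0]/(val (0 : mp)) raddf0 ffunE big1 // => b' _.
rewrite !ffunE /= !xpair_eqE; case: (b' =P b) => [->|_]; last by rewrite andbF mul0r.
by have /eqP/negPf -> := bc; rewrite mulr0.
Qed.

End MPAlgebra.

Local Open Scope mset_scope.

(* The alphabet [k] (inl) together with its barred copy (inr).                *)
Definition letter (k : nat) : finType := ('I_k + 'I_k)%type.

Definition mult (k : nat) (X : {mset {mset letter k}}) (v : letter k) : nat :=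
  (\sum_(B <- X) B v)%N.

Record mpart (r k : nat) : predArgType := MPart {
  mblocks :> {mset {mset letter k}};
  _ : [&& mset0 \notin mblocks,
          (\sum_(m < k) mult mblocks (inl m))%N == r
        & (\sum_(m < k) mult mblocks (inr m))%N == r]
}.

Section MultisetPartitions.
Variables r k : nat.
Implicit Types (a b : wcomp r k) (X : mpart r k).

Fact unbarred_subproof X : (\sum_(m < k) mult X (inl m))%N = r.
Proof. by case: X => Y /= /and3P[_ /eqP]. Qed.

Fact barred_subproof X : (\sum_(m < k) mult X (inr m))%N = r.
Proof. by case: X => Y /= /and3P[_ _ /eqP]. Qed.

Definition unbarred X : wcomp r k := wcomp_of (unbarred_subproof X).
Definition barred X : wcomp r k := wcomp_of (barred_subproof X).

Definition label a b (v : vertex r) : letter k :=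
  match v with inl i => inl (interval a i) | inr i => inr (interval b i) end.

Definition kappa a b (P : diagram r) : {mset {mset letter k}} :=
  seq_mset [seq seq_mset [seq label a b v | v <- enum B] | B : {set vertex r} <- enum P].

End MultisetPartitions.

Section DiagramLikeBasis.
Variables (K : numFieldType) (r k n : nat) (k_gt0 : (0 < k)%N).

(* The element s_a L_P s_b does not depend on the choice of P with            *)
(* kappa_(a,b)(P) = X, and such a P always exists.                            *)
Definition dlike (X : mpart r k) : MP K r n k_gt0 :=
  if [pick P | kappa (unbarred X) (barred X) P == mblocks X] is Some P
  then mp_single k_gt0 (unbarred X) (barred X) (dbasis K n P)
  else 0.

End DiagramLikeBasis.

Section Copies.
Variable k : nat.

Definition copies (T : Type) (a : 'I_k -> nat) (f : 'I_k -> T) : seq T :=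
  flatten [seq nseq (a m) (f m) | m <- enum 'I_k].

Lemma sum_copies (T : Type) (a : 'I_k -> nat) (f : 'I_k -> T) (F : T -> nat) :
  (\sum_(x <- copies a f) F x = \sum_m a m * F (f m))%N.
Proof.
rewrite /copies big_flatten big_map big_enum /=; apply: eq_bigr => m _.
by rewrite big_nseq iter_addn_0 mulnC.
Qed.

Lemma count_copies (T : eqType) (a : 'I_k -> nat) (f : 'I_k -> T) (v : T) :
  count_mem v (copies a f) = (\sum_m a m * (f m == v))%N.
Proof.
rewrite -sum1_count big_mkcond sum_copies; apply: eq_bigr => m _ /=.
by case: (f m == v).
Qed.

Lemma count_copies_inj (T : eqType) (a : 'I_k -> nat) (f : 'I_k -> T) (m : 'I_k) :
  injective f -> count_mem (f m) (copies a f) = a m.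
Proof.
move=> finj; rewrite count_copies (bigD1 m) //= eqxx muln1 big1 ?addn0 // => j.
by move=> /negPf jm; rewrite (inj_eq finj) jm muln0.
Qed.

Lemma count_copies_out (T : eqType) (a : 'I_k -> nat) (f : 'I_k -> T) (v : T) :
  (forall m, f m != v) -> count_mem v (copies a f) = 0%N.
Proof.
by move=> fv; rewrite count_copies big1 // => m _; rewrite (negPf (fv m)) muln0.
Qed.

Definition bars (a : 'I_k -> nat) : seq {mset letter k} :=
  copies a (fun m => [mset inl m; inr m]).

Definition big_block (a b : 'I_k -> nat) : {mset letter k} :=
  seq_mset (copies a inl ++ copies b inr).

Lemma big_blockl a b m : big_block a b (inl m) = a m.
Proof.
rewrite mset_seqE count_cat count_copies_inj; last by move=> ? ? [].
by rewrite count_copies_out ?addn0.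
Qed.

Lemma big_blockr a b m : big_block a b (inr m) = b m.
Proof.
rewrite mset_seqE count_cat addnC count_copies_inj; last by move=> ? ? [].
by rewrite count_copies_out ?addn0.
Qed.

Lemma mult_seq (s : seq {mset letter k}) v :
  mult (seq_mset s) v = (\sum_(B <- s) B v)%N.
Proof. exact/perm_big/perm_eq_seq_mset. Qed.

Lemma mem_seq_mset (s : seq {mset letter k}) B : (B \in seq_mset s) = (B \in s).
Proof. exact: (perm_mem (perm_eq_seq_mset s) B). Qed.

Lemma sum_bars_l a m : (\sum_(B <- bars a) B (inl m) = a m)%N.
Proof.
rewrite sum_copies (bigD1 m) //= big1 ?addn0 => [|j /negPf jm].
  by rewrite mset1DE msetnE /= eqxx muln1.
by rewrite mset1DE msetnE /= (inj_eq (@inl_inj _ _)) eq_sym jm muln0.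
Qed.

Lemma sum_bars_r a m : (\sum_(B <- bars a) B (inr m) = a m)%N.
Proof.
rewrite sum_copies (bigD1 m) //= big1 ?addn0 => [|j /negPf jm].
  by rewrite mset1DE msetnE /= eqxx muln1.
by rewrite mset1DE msetnE /= (inj_eq (@inr_inj _ _)) eq_sym jm muln0.
Qed.

Lemma mset0_bars a : mset0 \notin bars a.
Proof.
apply/negP => /flattenP[_ /mapP[m _ ->]].
by rewrite mem_nseq => /andP[_ /eqP/msetP/(_ (inl m))]; rewrite mset0E mset1DE eqxx.
Qed.

End Copies.

Section Generators.
Variables (r k : nat).

Definition P_blocks (i j : 'I_k) (a : wcomp r.-1 k) : {mset {mset letter k}} :=
  seq_mset ([:: [mset inl i]; [mset inr j]] ++ bars a).

Lemma P_blocksP (r_gt0 : (0 < r)%N) i j a :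
  [&& mset0 \notin P_blocks i j a,
      (\sum_(m < k) mult (P_blocks i j a) (inl m))%N == r
    & (\sum_(m < k) mult (P_blocks i j a) (inr m))%N == r].
Proof.
apply/and3P; split.
- have ne v : (mset0 == [mset v] :> {mset letter k}) = false.
    by apply/eqP => /msetP/(_ v); rewrite mset0E msetnxx.
  rewrite /P_blocks mem_seq_mset mem_cat (negPf (mset0_bars _)) orbF.
  by rewrite in_cons mem_seq1 !ne.
- under eq_bigr => m _ do
    rewrite mult_seq big_cat /= sum_bars_l big_cons big_seq1 !msetnE addn0.
  rewrite big_split /= sum_wcomp (bigD1 i) //= eqxx big1 => [|m /negPf mi].
    by rewrite addn0 add1n prednK.
  by rewrite (inj_eq (@inl_inj _ _)) mi.
- under eq_bigr => m _ do
    rewrite mult_seq big_cat /= sum_bars_r big_cons big_seq1 !msetnE add0n.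
  rewrite big_split /= sum_wcomp (bigD1 j) //= eqxx big1 => [|m /negPf mj].
    by rewrite addn0 add1n prednK.
  by rewrite (inj_eq (@inr_inj _ _)) mj.
Qed.

Definition R_blocks (i : nat) (a b : wcomp i k) (c : wcomp (r - i) k) :
    {mset {mset letter k}} :=
  seq_mset (big_block a b :: bars c).

Lemma R_blocksP (i : nat) (hi : (0 < i <= r)%N) a b c :
  [&& mset0 \notin @R_blocks i a b c,
      (\sum_(m < k) mult (R_blocks a b c) (inl m))%N == r
    & (\sum_(m < k) mult (R_blocks a b c) (inr m))%N == r].
Proof.
have [i0 ir] := andP hi; apply/and3P; split.
- rewrite /R_blocks mem_seq_mset in_cons (negPf (mset0_bars _)) orbF.
  apply/eqP => /esym/msetP e; move: i0; rewrite -(sum_wcomp a) big1 // => m _.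
  by rewrite -(big_blockl a b) e mset0E.
- under eq_bigr => m _ do rewrite mult_seq big_cons sum_bars_l big_blockl.
  by rewrite big_split /= !sum_wcomp subnKC.
- under eq_bigr => m _ do rewrite mult_seq big_cons sum_bars_r big_blockr.
  by rewrite big_split /= !sum_wcomp subnKC.
Qed.

Variables (K : numFieldType) (n : nat) (r_gt0 : (0 < r)%N) (k_gt0 : (0 < k)%N).

Definition P_gen (i j : 'I_k) (a : wcomp r.-1 k) : MP K r n k_gt0 :=
  dlike K n k_gt0 (MPart (P_blocksP r_gt0 i j a)).

Definition R_gen (i : nat) (hi : (0 < i <= r)%N) (a b : wcomp i k)
    (c : wcomp (r - i) k) : MP K r n k_gt0 :=
  dlike K n k_gt0 (MPart (R_blocksP hi a b c)).

Definition Theta (x : MP K r n k_gt0) : Prop :=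
  (exists i j a, x = P_gen i j a) \/
  (exists i (hi : (0 < i <= r)%N) a b c, x = @R_gen i hi a b c).

End Generators.

(* The smallest unital subalgebra containing S is A.                          *)
Definition generates (K : nzRingType) (A : algType K) (S : A -> Prop) : Prop :=
  forall B : {pred A}, GRing.subalg_closed B -> (forall x, S x -> x \in B) ->
  forall x, x \in B.

(* Main.v *)
From HB Require Import structures.
Require Import Defs.
From mathcomp Require Import all_boot all_order all_algebra all_fingroup.
From mathcomp Require Import finmap multiset boolp.

(* Let B be a subalgebra containing Theta. Allowing arbitrary, not            *)
(* necessarily sorted, labels a and b of the two rows, write el a b P for the *)
(* basis element of the diagram P labelled by a and b. A product              *)
(* el a b P * el b d Q is, up to a positive factor, the sum of n^c el a d     *)
(* (P s Q) over the permutations s that preserve b, so el a d (P Q) lies in B *)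
(* as soon as all terms not isomorphic to it do and P Q has c = 0.            *)
(* Call a block trivial if it is a singleton or a vertical bar, mark a block  *)
(* A of P, and induct on the number N of other nontrivial blocks, then on the *)
(* size of A, large blocks first.                                             *)
(* - A singleton block {i} in the bottom row, other than A, is moved into A;  *)
(*   multiplying by P_(j,j,c), where j is the label of i, detaches a vertex   *)
(*   labelled j: if it comes from A this gives P, otherwise A has grown.      *)
(* - If all blocks but A are bars, el a b P is a generator R_(a,b,c).         *)
(* - Otherwise take a nontrivial block C other than A with at least as many   *)
(*   bottom as top vertices, break it up into bars and bottom singletons, and *)
(*   multiply by the R that fuses the bottom vertices of C: a term that hits  *)
(*   A or a nontrivial block has smaller N, one that leaves out a singleton   *)
(*   is covered by the first case, and the others are isomorphic to P.        *)
(* The remaining cases follow by exchanging the two rows.                     *)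

Set Implicit Arguments.
Unset Strict Implicit.
Unset Printing Implicit Defensive.

Import GRing.Theory Num.Theory.

Local Open Scope nat_scope.
Local Open Scope set_scope.
Local Open Scope mset_scope.

(** * Diagrams and their products *)

(** The elements [el a b P] span the algebra ([el_span]), so it suffices to place each of them in a
    given subalgebra containing the generators. The obstacle is that the idempotent between two
    factors averages over the permutations of equally labelled middle vertices: a product is a sum
    of diagrams, not a single one ([el_mul]). The terms isomorphic to the intended diagram and
    without middle components have coefficient 1, and the identity permutation gives one of them.
    Their total coefficient is thus a positive integer, and the intended element is obtained once
    all other terms are. [Theta_mult_closed] turns this into the principle [mult_closed], which is
    all that the combinatorial part knows about the algebra.

    Two operations on the bottom row suffice: a knife detaches a vertex, a fusion merges the blocks
    that meet a set of vertices. The marked block A controls the stray terms. When a lone vertex is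
    recovered by cutting it off an enlarged A ([lone_step]), a stray cut leaves A enlarged. When a
    nontrivial block C is recovered by fusing its fragments ([split_step]), the fragments form a
    diagram with fewer nontrivial blocks. A stray fusion creates at most one more, and makes up for
    it if it swallows A or another nontrivial block; if it misses a lone vertex, [lone_step]
    applies; if it differs only in the choice of bars, it gives the same multiset partition
    ([kap_meld_perm]) and is not stray at all.

    Diagrams with neither such a C nor a singleton outside A are generators ([R_el]), flipping
    exchanges the rows ([mirror_closed]), and [closed_all] runs the induction. *)

Section Diagrams.
Variable r : nat.
Implicit Types (P Q : diagram r) (u v : vertex r) (S : {set 'I_r}).

Lemma mem_pblockE P u v : (v \in pblock P u) = same_block P u v.
Proof.
have c w : w \in cover P by rewrite (cover_partition (valP P)) inE.
by rewrite /same_block eq_pblock ?c ?(partition_trivIset (valP P)).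
Qed.

Lemma same_blockC P u v : same_block P u v = same_block P v u.
Proof. exact: eq_sym. Qed.

Lemma pblock_in P u : pblock P u \in blocks P.
Proof. by rewrite pblock_mem ?(cover_partition (valP P)) ?inE. Qed.

Lemma blockP P (C : {set vertex r}) :
  reflect (exists u, C = pblock P u) (C \in blocks P).
Proof.
apply: (iffP idP) => [CP|[u ->]]; last exact: pblock_in.
have : C != set0 by apply: contraTneq CP => ->; case/and3P: (valP P).
case/set0Pn=> u uC; exists u.
by rewrite (def_pblock (partition_trivIset (valP P)) CP uC).
Qed.

Lemma pblock_block P (C : {set vertex r}) u :
  C \in blocks P -> u \in C -> pblock P u = C.
Proof. exact/def_pblock/partition_trivIset/(valP P). Qed.

Lemma pblock_self P u : u \in pblock P u.
Proof. by rewrite mem_pblockE /same_block. Qed.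

Lemma block_neq0 P (C : {set vertex r}) : C \in blocks P -> C != set0.
Proof. by case/blockP=> u ->; apply/set0Pn; exists u; apply: pblock_self. Qed.

Lemma block_disjoint P (C D : {set vertex r}) u :
  C \in blocks P -> D \in blocks P -> u \in C -> u \in D -> C = D.
Proof. by move=> CP DP uC uD; rewrite -(pblock_block CP uC) (pblock_block DP uD). Qed.

(** Diagrams are built as kernels of maps: the partition condition is then automatic and the block
    relation becomes an equality test. *)
Definition kerd (T : eqType) (f : vertex r -> T) : diagram r :=
  Diagram (preim_partitionP f [set: vertex r]).

Lemma same_kerd (T : eqType) (f : vertex r -> T) u v :
  same_block (kerd f) u v = (f u == f v).
Proof.
rewrite -mem_pblockE pblock_equivalence_partition ?inE //.
by move=> a b c _ _ _; split=> //= /eqP ->.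
Qed.

Definition idx v : 'I_r := match v with inl i => i | inr i => i end.

Definition flipv v : vertex r := match v with inl i => inr i | inr i => inl i end.

Lemma flipvK : involutive flipv. Proof. by case. Qed.

Definition flip P : diagram r := kerd (fun v => pblock P (flipv v)).

Lemma same_flip P u v : same_block (flip P) u v = same_block P (flipv u) (flipv v).
Proof. exact: same_kerd. Qed.

Opaque flip.

Lemma flipK : involutive flip.
Proof. by move=> P; apply: diagram_eq => u v; rewrite same_flip same_flip !flipvK. Qed.

Definition mv (s t : 'S_r) v : vertex r :=
  match v with inl i => inl (s i) | inr i => inr (t i) end.

Definition relab (s t : 'S_r) P : diagram r := kerd (fun v => pblock P (mv s t v)).

Lemma same_relab s t P u v : same_block (relab s t P) u v = same_block P (mv s t u) (mv s t v).
Proof. exact: same_kerd. Qed.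

Opaque relab.

Lemma mvM s t s' t' v : mv s t (mv s' t' v) = mv (s' * s)%g (t' * t)%g v.
Proof. by case: v => i /=; rewrite permM. Qed.

Lemma mv1 v : mv 1%g 1%g v = v. Proof. by case: v => i /=; rewrite perm1. Qed.

Lemma relabM s t s' t' P : relab s t (relab s' t' P) = relab (s * s')%g (t * t')%g P.
Proof. by apply: diagram_eq => u v; rewrite same_relab same_relab same_relab !mvM. Qed.

Lemma relab1 P : relab 1%g 1%g P = P.
Proof. by apply: diagram_eq => u v; rewrite same_relab !mv1. Qed.

Lemma flip_relab s t P : flip (relab s t P) = relab t s (flip P).
Proof.
apply: diagram_eq => u v; rewrite same_flip same_relab same_relab same_flip.
by case: u; case: v.
Qed.

Definition cmp (x : colouring r) (s : 'S_r) : colouring r := [ffun i => x (s i)].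

Lemma cmpM x s t : cmp (cmp x s) t = cmp x (t * s)%g.
Proof. by apply/ffunP => i; rewrite !ffunE permM. Qed.

Lemma cmp1 x : cmp x 1%g = x.
Proof. by apply/ffunP => i; rewrite ffunE perm1. Qed.

Lemma mat_relab s t P x z : mat (relab s t P) x z = mat P (cmp x s^-1%g) (cmp z t^-1%g).
Proof.
congr nat_of_bool; have gE v : glue (cmp x s^-1%g) (cmp z t^-1%g) (mv s t v) = glue x z v.
  by case: v => i /=; rewrite ffunE permK.
apply/compatP/compatP => h u v.
  move=> uv; have mK w : w = mv s t (mv s^-1%g t^-1%g w) by rewrite mvM !mulVg mv1.
  by rewrite (mK u) (mK v) !gE; apply: h; rewrite same_relab -!mK.
by rewrite same_relab => /h; rewrite !gE.
Qed.

Lemma mat_flip P x z : mat (flip P) x z = mat P z x.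
Proof.
congr nat_of_bool; have gE v : glue x z (flipv v) = glue z x v by case: v.
apply/compatP/compatP => h u v uv.
  by rewrite -!gE; apply: h; rewrite same_flip !flipvK.
rewrite same_flip in uv; rewrite -[u]flipvK -[v]flipvK !gE; exact: h.
Qed.

(** By [mat_inj], a power of 2 times a colouring matrix determines both the exponent and the
    diagram, so a single count of two-colourings yields the composite together with its number of
    middle components. *)
Lemma compose_by_mat P Q c D :
  (forall x z, \sum_y mat P x y * mat Q y z = 2 ^ c * mat D x z) ->
  nb_middle P Q = c /\ compose P Q = D.
Proof. by move=> h; apply: mat_inj => x z; rewrite -h mat_compose. Qed.

Lemma compose_flip P Q :
  nb_middle (flip Q) (flip P) = nb_middle P Q /\
  compose (flip Q) (flip P) = flip (compose P Q).
Proof.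
apply: compose_by_mat => x z; rewrite mat_flip -mat_compose.
by apply: eq_bigr => y _; rewrite !mat_flip mulnC.
Qed.

(** Recolouring the middle row by [t] shows that only the relative permutation of the two middle
    rows matters. *)
Lemma compose_relab s t (s' t' : 'S_r) P Q :
  nb_middle (relab s t P) (relab s' t' Q) = nb_middle P (relab (t^-1 * s')%g 1%g Q) /\
  compose (relab s t P) (relab s' t' Q) = relab s t' (compose P (relab (t^-1 * s')%g 1%g Q)).
Proof.
apply: compose_by_mat => x z; rewrite mat_relab -mat_compose.
have cinj : injective (cmp^~ t).
  by move=> a b /(congr1 (cmp^~ t^-1%g)); rewrite !cmpM mulVg !cmp1.
rewrite (reindex_inj cinj) /=; apply: eq_bigr => y _.
rewrite !mat_relab !cmpM mulVg invg1 !cmp1.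
by rewrite invMg invgK mul1g.
Qed.

Lemma compose_permdl s Q :
  nb_middle (perm_diagram s) Q = 0 /\ compose (perm_diagram s) Q = relab s^-1%g 1%g Q.
Proof.
apply: compose_by_mat => x z; rewrite mul1n mat_relab invgK invg1 cmp1.
rewrite (bigD1 (cmp x s)) //= big1 ?addn0 => [|y /negPf yE].
  by rewrite mat_perm eqxx mul1n.
by rewrite mat_perm yE.
Qed.

Lemma compose_permdr s Q :
  nb_middle Q (perm_diagram s) = 0 /\ compose Q (perm_diagram s) = relab 1%g s Q.
Proof.
apply: compose_by_mat => x z; rewrite mul1n mat_relab invg1 cmp1.
rewrite (bigD1 (cmp z s^-1%g)) //= big1 ?addn0 => [|y yE].
  rewrite mat_perm -/(cmp (cmp z s^-1%g) s).
  by rewrite cmpM mulgV cmp1 eqxx muln1.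
rewrite mat_perm; case: (z =P _) yE => [->|]; last by rewrite /= muln0.
by rewrite -/(cmp y s) cmpM mulVg cmp1 eqxx.
Qed.

(* The bars on the columns outside S, all columns of S in one block.          *)
Definition fuse S : diagram r :=
  kerd (fun v => if idx v \in S then None else Some (idx v)).

Definition meld P S : diagram r :=
  kerd (fun v => if [exists i in S, inr i \in pblock P v] then None else Some (pblock P v)).

(** Column [i] gets one key per vertex, hence two singletons; any other column has one common key,
    hence a bar. *)
Definition knife (i : 'I_r) : diagram r :=
  kerd (fun v => if idx v == i then inl v else inr (idx v)).

Definition cut P (i : 'I_r) : diagram r :=
  kerd (fun v => if v == inr i then None else Some (pblock P v)).

Lemma relab_fuse s S : relab s s (fuse S) = fuse (s @^-1: S).
Proof.
apply: diagram_eq => u v; rewrite same_relab !same_kerd.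
have idxE w : idx (mv s s w) = s (idx w) by case: w.
rewrite !idxE !inE; case: ifP => _; case: ifP => _ //.
by rewrite !(inj_eq Some_inj) (inj_eq perm_inj).
Qed.

Lemma relab_knife s i : relab s s (knife (s i)) = knife i.
Proof.
apply: diagram_eq => u v; rewrite same_relab !same_kerd.
have idxE w : idx (mv s s w) = s (idx w) by case: w.
rewrite !idxE !(inj_eq perm_inj); case: ifP => _; case: ifP => _ //.
  rewrite !(inj_eq inl_inj); case: u => i1; case: v => i2 //=.
    by rewrite !(inj_eq inl_inj) (inj_eq perm_inj).
  by rewrite !(inj_eq inr_inj) (inj_eq perm_inj).
by rewrite !(inj_eq inr_inj) (inj_eq perm_inj).
Qed.

Lemma compose_fuse P S :
  nb_middle P (fuse S) = 0 /\ compose P (fuse S) = meld P S.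
Proof.
apply: compose_by_mat => x z; rewrite mul1n.
(* The fusion forces the middle colouring to equal the bottom one, so the sum over [y] reduces to
   the term [y = z]. *)
have mE y : mat (fuse S) y z =
    (y == z) && [forall i in S, forall j in S, z i == z j].
  congr nat_of_bool; apply/compatP/andP => [h|[/eqP-> h] u v].
    split.
      apply/eqP/ffunP => i; apply: (h (inl i) (inr i)); rewrite same_kerd /=.
      by case: ifP.
    apply/'forall_implyP => i iS; apply/'forall_implyP => j jS; apply/eqP.
    by apply: (h (inr i) (inr j)); rewrite same_kerd /= iS jS.
  have gE w : glue z z w = z (idx w) by case: w.
  rewrite same_kerd !gE; case: ifP => uS; case: ifP => vS //; last by case/eqP=> ->.
  by move: h => /'forall_implyP/(_ _ uS)/'forall_implyP/(_ _ vS)/eqP.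
rewrite (bigD1 z) //= big1 ?addn0 => [|y /negPf yz]; last by rewrite mE yz muln0.
rewrite mE eqxx /= mulnb; congr nat_of_bool.
apply/andP/compatP => [[/compatP hP hS] u v|h].
  rewrite same_kerd; case: ifP => [/existsP[i /andP[iS iu]]|_].
    case: ifP => // /existsP[j /andP[jS jv]] _.
    rewrite mem_pblockE in iu; rewrite mem_pblockE in jv.
    rewrite (hP _ _ iu) (hP _ _ jv) /=.
    by move: hS => /'forall_implyP/(_ _ iS)/'forall_implyP/(_ _ jS)/eqP.
  by case: ifP => // _; rewrite (inj_eq Some_inj) => /hP.
split.
  apply/compatP => u v /eqP uv; apply: h; rewrite same_kerd uv.
  by case: ifP.
apply/'forall_implyP => i iS; apply/'forall_implyP => j jS; apply/eqP.
apply: (h (inr i) (inr j)); rewrite same_kerd.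
have t l : l \in S -> [exists i in S, inr i \in pblock P (inr l)].
  by move=> lS; apply/existsP; exists l; rewrite lS pblock_self.
by rewrite !t.
Qed.

Lemma mat_knife i y z : mat (knife i) y z = [forall j, (j != i) ==> (y j == z j)].
Proof.
congr nat_of_bool; apply/compatP/'forall_implyP => [h j ji|h u v].
  by apply/eqP/(h (inl j) (inr j)); rewrite same_kerd /= (negPf ji).
rewrite same_kerd; case: ifP => ui; case: ifP => vi //; first by case/eqP => ->.
rewrite (inj_eq inr_inj) => /eqP uv; have := h _ (negbT vi).
by case: u ui uv => u ui /= uv; case: v vi uv => v vi /= -> // /eqP.
Qed.

Lemma compose_knife_single P i : pblock P (inr i) = [set inr i] ->
  compose P (knife i) = P.
Proof.
move=> Pi; suff: nb_middle P (knife i) = 1 /\ compose P (knife i) = P by case.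
apply: compose_by_mat => x z; rewrite expn1.
(* The middle colouring is [z] away from [i] and free at [i]. Since [inr i] is alone in its block
   both values are compatible with [P]: this is the factor 2 of the one middle component. *)
pose w b : colouring r := [ffun j => if j == i then b else z j].
have wE y : mat (knife i) y z = (y == w true) || (y == w false).
  rewrite mat_knife; congr nat_of_bool; apply/'forall_implyP/orP => [h|h j ji].
    have yw : y = w (y i).
      by apply/ffunP => j; rewrite ffunE; case: eqP => [->//|/eqP/h/eqP].
    by rewrite yw; case: (y i); [left|right].
  by case: h => /eqP->; rewrite ffunE (negPf ji).
have wn : w false != w true.
  by apply/eqP => /ffunP/(_ i); rewrite !ffunE eqxx.
have Pw b : mat P x (w b) = mat P x z.
  have gE v : v != inr i -> glue x (w b) v = glue x z v.
    by case: v => j //=; rewrite ffunE; case: (j =P i) => // ->; rewrite eqxx.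
  have iE v : same_block P (inr i) v -> v = inr i.
    by rewrite -mem_pblockE Pi inE => /eqP.
  congr nat_of_bool; apply/compatP/compatP => h u v uv;
    case: (eqVneq u (inr i)) (uv) => [-> /iE-> //|ui _];
    case: (eqVneq v (inr i)) (uv) => [-> |vi _]; try by rewrite same_blockC => /iE->.
    by rewrite -!gE //; apply: h.
  by rewrite !gE //; apply: h.
rewrite (bigD1 (w true)) //= (bigD1 (w false)) //= big1 ?addn0 => [|y /andP[y1 y2]].
  by rewrite !wE !eqxx orbT !Pw !muln1 mul2n addnn.
by rewrite wE (negPf y1) (negPf y2) muln0.
Qed.

Lemma compose_knife_cut P i : pblock P (inr i) != [set inr i] ->
  nb_middle P (knife i) = 0 /\ compose P (knife i) = cut P i.
Proof.
(* A companion [w] of [inr i] in its block dictates the middle colour at [i], so only the colouring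
   [y0] can contribute. *)
move=> Pi; have [w wi wP] : exists2 w, w != inr i & same_block P (inr i) w.
  have : 1 < #|pblock P (inr i)|.
    rewrite ltnNge; apply: contra Pi => c; rewrite eq_sym eqEcard sub1set.
    by rewrite pblock_self cards1.
  case/card_gt1P=> a [b [aP bP ab]]; case: (eqVneq a (inr i)) => [ai|]; last first.
    by exists a; rewrite -?mem_pblockE.
  by exists b; [rewrite -ai eq_sym | rewrite -mem_pblockE].
apply: compose_by_mat => x z; rewrite mul1n.
pose y0 : colouring r := [ffun j => if j == i then glue x z w else z j].
have gE (y : colouring r) v : (forall j, j != i -> y j = z j) -> v != inr i ->
    glue x y v = glue x z v.
  by move=> yz; case: v => j //= ji; apply: yz; apply: contraNneq ji => ->.
rewrite (bigD1 y0) //= big1 ?addn0 => [|y yy0]; last first.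
  rewrite mat_knife; case: forallP => [yz|]; last by rewrite muln0.
  rewrite muln1 /mat; case: compatP => //= h; case/eqP: yy0.
  have {}yz j : j != i -> y j = z j by move=> ji; apply/eqP/(implyP (yz j)).
  apply/ffunP => j; rewrite ffunE; case: eqVneq => [->|/yz //].
  by rewrite -(gE y) // -(h _ _ wP).
have y0z j : j != i -> y0 j = z j by move=> ji; rewrite ffunE (negPf ji).
rewrite mat_knife; case: forallP => [_|[j]]; last first.
  by apply/implyP => /y0z ->.
rewrite muln1; congr nat_of_bool; apply/compatP/compatP => h u v.
  rewrite same_kerd; case: (eqVneq u (inr i)) => [->|ui];
    case: (eqVneq v (inr i)) => [->|vi] //.
  by rewrite (inj_eq Some_inj) -!(gE y0) // => /h.
have y0i : glue x y0 (inr i) = glue x z w by rewrite /= ffunE eqxx.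
move=> uv; case: (eqVneq u (inr i)) uv => [->|ui]; case: (eqVneq v (inr i)) => [->|vi] //.
- rewrite y0i (gE y0) // => uv; apply: h; rewrite same_kerd (negPf wi) (negPf vi).
  by rewrite (inj_eq Some_inj) -(eqP uv) -(eqP wP).
- rewrite y0i (gE y0) // => uv; apply: h; rewrite same_kerd (negPf wi) (negPf ui).
  by rewrite (inj_eq Some_inj) (eqP uv) -(eqP wP).
- move=> uv; rewrite !(gE y0) //; apply: h; rewrite same_kerd (negPf ui) (negPf vi).
  by rewrite (inj_eq Some_inj).
Qed.

End Diagrams.

Arguments flipv {r}.

(** * Labelled diagrams and the generators *)

(** Each fibre is listed, and elements at equal positions of corresponding lists are matched. *)
Lemma fiber_bij (X Y : finType) (Z : eqType) (F : X -> Z) (G : Y -> Z) :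
  (forall z, #|[pred x | F x == z]| = #|[pred y | G y == z]|) ->
  exists2 h : X -> Y, injective h & forall x, G (h x) = F x.
Proof.
move=> FG.
have hx x : {y | G y == F x}.
  apply: sigW; have : 0 < #|[pred y | G y == F x]|.
    by rewrite -FG; apply/card_gt0P; exists x; rewrite inE.
  by case/card_gt0P => y; exists y.
pose eX z := enum [pred x | F x == z]; pose eY z := enum [pred y | G y == z].
have ix x : index x (eX (F x)) < size (eY (F x)).
  by rewrite -cardE -FG cardE index_mem mem_enum inE.
(* Only a default for [nth], whose value is irrelevant because all indices are in range. *)
have [d _] : exists d : X -> Y, True by exists (fun x => sval (hx x)).
pose h x := nth (d x) (eY (F x)) (index x (eX (F x))).
have Gh x : G (h x) = F x.
  by have := mem_nth (d x) (ix x); rewrite mem_enum inE => /eqP.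
exists h => // x x' xx'; have Fxx : F x' = F x by rewrite -!Gh xx'.
move: (ix x') xx'; rewrite /h Fxx => ix'.
rewrite (set_nth_default (d x) (d x')) //.
move/eqP; rewrite nth_uniq ?enum_uniq // => /eqP xx'.
have mX y : F y = F x -> y \in eX (F x) by move=> Fy; rewrite mem_enum inE Fy.
by rewrite -(nth_index x (mX x erefl)) xx' nth_index ?mX.
Qed.

(** * Labelled diagrams up to isomorphism *)

Section Labels.
Variables r k : nat.
Local Notation lab := ('I_r -> 'I_k).
Local Notation interval := Defs.interval.
Implicit Types (a b : lab) (P Q : diagram r).

Definition llab a b (v : vertex r) : letter k :=
  match v with inl i => inl (a i) | inr i => inr (b i) end.

Definition cont (f : vertex r -> letter k) (B : {set vertex r}) : {mset letter k} :=
  seq_mset [seq f v | v <- enum B].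

Definition kap (f : vertex r -> letter k) P : {mset {mset letter k}} :=
  seq_mset [seq cont f B | B <- enum (blocks P)].

Lemma contE f B l : cont f B l = #|[pred v in B | f v == l]|.
Proof.
rewrite mset_seqE count_map -size_filter cardE; apply/perm_size.
apply: uniq_perm; [exact/filter_uniq/enum_uniq | exact: enum_uniq | move=> v].
by rewrite mem_filter !mem_enum !inE andbC.
Qed.

Lemma kapE f P M : kap f P M = #|[pred B in blocks P | cont f B == M]|.
Proof.
rewrite mset_seqE count_map -size_filter cardE; apply/perm_size.
apply: uniq_perm; [exact/filter_uniq/enum_uniq | exact: enum_uniq | move=> v].
by rewrite mem_filter !mem_enum !inE andbC.
Qed.

(** Two matchings by [fiber_bij]: blocks with equal contents first, then vertices with equal labels
    inside matched blocks. *)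
Lemma kap_bij f g P Q : kap f P = kap g Q ->
  exists h : vertex r -> vertex r, [/\ injective h, (forall v, g (h v) = f v) &
    forall u v, same_block Q (h u) (h v) = same_block P u v].
Proof.
move=> fg; have PQ : #|blocks P| = #|blocks Q|.
  by move/eq_seq_msetP/perm_size: fg; rewrite !size_map -!cardE.
(* Sending every non-block to [None] makes this a matching of all vertex sets; the fibres over
   [None] agree because the numbers of blocks do. *)
pose col f P (B : {set vertex r}) := if B \in blocks P then Some (cont f B) else None.
have [z|h hinj hE] := @fiber_bij _ _ _ (col f P) (col g Q).
  case: z => [M|].
    have cE f' P' : #|[pred B | col f' P' B == Some M]| = kap f' P' M.
      rewrite kapE; apply: eq_card => B; rewrite !inE /col.
      by case: ifP => // _; rewrite (inj_eq Some_inj).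
    by rewrite !cE fg.
  have cE f' P' : #|[pred B | col f' P' B == None]| = #|~: blocks P'|.
    by apply: eq_card => B; rewrite !inE /col; case: ifP.
  apply/eqP; rewrite !cE -(eqn_add2l #|blocks P|) cardsC.
  by rewrite PQ cardsC.
have hP B : (h B \in blocks Q) = (B \in blocks P).
  by have := hE B; rewrite /col; do 2 case: ifP.
have hc B : B \in blocks P -> cont g (h B) = cont f B.
  by move=> BP; have := hE B; rewrite /col hP BP => -[].
have [h' hK' hK] := injF_bij hinj.
have [[B l]|H Hinj HE] := @fiber_bij _ _ _ (fun v => (h (pblock P v), f v))
    (fun v => (pblock Q v, g v)).
  have [BQ|BQ] := boolP (B \in blocks Q); last first.
    rewrite !eq_card0 // => v; rewrite !inE xpair_eqE; apply/negbTE/negP => /andP[/eqP vB _].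
      by rewrite -vB pblock_in in BQ.
    by rewrite -vB hP pblock_in in BQ.
  have pE P' B' v : B' \in blocks P' -> (pblock P' v == B') = (v \in B').
    move=> BP'; apply/eqP/idP => [<-|]; [exact: pblock_self | exact: pblock_block].
  have BP : h' B \in blocks P by rewrite -hP hK.
  transitivity (cont f (h' B) l).
    rewrite contE; apply: eq_card => v; rewrite !inE xpair_eqE.
    by rewrite -[B in _ == B]hK (inj_eq hinj) pE.
  rewrite -hc // hK contE; apply: eq_card => v; rewrite !inE xpair_eqE.
  by rewrite pE.
have hb u : pblock Q (H u) = h (pblock P u) by case: (HE u).
exists H; split=> // [v|u v]; first by case: (HE v).
by rewrite /same_block !hb (inj_eq hinj).
Qed.

Definition iso a b P a' b' Q : Prop :=
  exists s t : 'S_r, [/\ a' \o s =1 a, b' \o t =1 b & relab s t Q = P].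

Lemma iso_refl a b P : iso a b P a b P.
Proof. by exists 1%g, 1%g; split=> [i|i|]; rewrite ?relab1 //= perm1. Qed.

Lemma iso_trans a b P a' b' Q a'' b'' X :
  iso a b P a' b' Q -> iso a' b' Q a'' b'' X -> iso a b P a'' b'' X.
Proof.
case=> s [t [sE tE <-]] [s' [t' [sE' tE' <-]]].
exists (s * s')%g, (t * t')%g; split=> [i|i|].
- by rewrite /= permM -sE /= -sE'.
- by rewrite /= permM -tE /= -tE'.
- by rewrite relabM.
Qed.

(** A label records its row, so the label-preserving bijection of [kap_bij] splits into one
    permutation per row. *)
Lemma kap_iso a b P a' b' Q :
  kap (llab a b) P = kap (llab a' b') Q -> iso a b P a' b' Q.
Proof.
case/kap_bij => h [hinj hl hP].
have [fL hL] : exists f, forall i, h (inl i) = inl (f i).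
  have hL i : {j | h (inl i) = inl j}.
    by have := hl (inl i); case: (h (inl i)) => // j _; exists j.
  by exists (fun i => sval (hL i)) => i; exact: svalP (hL i).
have [fR hR] : exists f, forall i, h (inr i) = inr (f i).
  have hR i : {j | h (inr i) = inr j}.
    by have := hl (inr i); case: (h (inr i)) => // j _; exists j.
  by exists (fun i => sval (hR i)) => i; exact: svalP (hR i).
have Linj : injective fL.
  by move=> i j ij; apply: (@inl_inj _ 'I_r); apply: hinj; rewrite !hL ij.
have Rinj : injective fR.
  by move=> i j ij; apply: (@inr_inj 'I_r); apply: hinj; rewrite !hR ij.
exists (perm Linj), (perm Rinj); split=> [i|i|].
- by rewrite /= permE; have := hl (inl i); rewrite hL => -[].
- by rewrite /= permE; have := hl (inr i); rewrite hR => -[].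
apply: diagram_eq => u v; rewrite same_relab -hP.
have mE w : mv (perm Linj) (perm Rinj) w = h w.
  by case: w => i /=; rewrite permE ?hL ?hR.
by rewrite !mE.
Qed.

Lemma iso_kap a b P a' b' Q :
  iso a b P a' b' Q -> kap (llab a b) P = kap (llab a' b') Q.
Proof.
case=> s [t [sE tE <-]]; apply/msetP => M; rewrite !kapE.
have minj : injective (mv s t).
  by move=> u v /(congr1 (mv s^-1%g t^-1%g)); rewrite !mvM !mulgV !mv1.
have cE (B : {set vertex r}) : cont (llab a' b') (mv s t @: B) = cont (llab a b) B.
  apply/msetP => l; rewrite !contE -[RHS](card_imset _ minj).
  have lE u : llab a' b' (mv s t u) = llab a b u.
    by case: u => i /=; [rewrite -sE | rewrite -tE].
  apply: eq_card => v; rewrite !inE; apply/andP/imsetP => [[/imsetP[u uB ->] ul]|[u]].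
    by exists u; rewrite // inE uB -lE.
  by rewrite inE => /andP[uB ul] ->; rewrite imset_f // lE.
have bE u : mv s t @: pblock (relab s t Q) u = pblock Q (mv s t u).
  apply/setP => v; rewrite mem_pblockE; apply/imsetP/idP => [[w]|uv].
    by rewrite mem_pblockE same_relab => uw ->.
  exists (mv s^-1%g t^-1%g v); last by rewrite mvM !mulVg mv1.
  by rewrite mem_pblockE same_relab mvM !mulVg mv1.
rewrite -(card_imset _ (imset_inj minj)); apply: eq_card => C; rewrite !inE.
apply/imsetP/andP => [[B]|[/blockP[u ->] cM]].
  rewrite inE => /andP[/blockP[u ->] cM] ->; rewrite bE pblock_in.
  by rewrite -bE cE.
exists (pblock (relab s t Q) (mv s^-1%g t^-1%g u)); last first.
  by rewrite bE mvM !mulVg mv1.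
by rewrite inE pblock_in -cE bE mvM !mulVg mv1.
Qed.

Lemma sum_fibers (f : 'I_r -> 'I_k) : \sum_m #|[pred i | f i == m]| = r.
Proof.
rewrite -[RHS]card_ord -sum1_card (partition_big f xpredT) //=.
by apply: eq_bigr => m _; rewrite sum1_card.
Qed.

Definition wt a : wcomp r k := wcomp_of (sum_fibers a).

Lemma wcomp_eq s (w w' : wcomp s k) : (forall m, w m = w' m) -> w = w'.
Proof.
by move=> ww; apply/val_inj/eq_from_tnth => m; apply/val_inj/ww.
Qed.

Lemma card_interval (w : wcomp r k) m : #|[pred i | interval w i == m]| = w m.
Proof.
set sh := map val (wtuple w).
have shr : sumn sh = r by apply/eqP/(valP w).
have shm : nth 0 sh m = w m.
  by rewrite /sh (nth_map ord0) ?size_tuple // /wfun (tnth_nth ord0).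
have fr (c : 'I_(w m)) : flatten_index sh m c < r.
  by rewrite -[X in _ < X]shr flatten_indexP ?shm.
rewrite -[RHS]card_ord -(@card_imset _ _ (fun c => Ordinal (fr c))); last first.
  move=> c c' /(congr1 val) /=; rewrite /flatten_index => /addnI cc.
  exact: val_inj.
apply: eq_card => i; rewrite !inE; apply/eqP/imsetP => [im|[c _ ->]].
  have iS : i < sumn sh by rewrite shr.
  have off : reshape_offset sh i < w m.
    by have := reshape_offsetP iS; rewrite -/sh -shm -im.
  exists (Ordinal off) => //; apply: val_inj; rewrite /= -[LHS](reshape_indexK sh).
  by rewrite -im.
by apply: val_inj; rewrite /= flatten_indexKl ?shm.
Qed.

Lemma wt_interval (w : wcomp r k) : wt (interval w) = w.
Proof. by apply: wcomp_eq => m; rewrite wcomp_ofE card_interval. Qed.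

Lemma wt_perm a a' (s : 'S_r) : a' \o s =1 a -> wt a = wt a'.
Proof.
move=> sE; apply: wcomp_eq => m; rewrite !wcomp_ofE.
rewrite -(card_imset _ (@perm_inj _ s)); apply: eq_card => i; rewrite !inE.
apply/imsetP/eqP => [[j]|im]; first by rewrite inE => /eqP <- ->; rewrite -sE.
by exists (s^-1%g i); rewrite ?inE -?sE /= permKV ?im.
Qed.

Lemma srt_subproof a : exists s : 'S_r, [forall i, a (s i) == interval (wt a) i].
Proof.
have [m|h hinj hE] := @fiber_bij _ _ _ (interval (wt a)) a.
  by rewrite card_interval wcomp_ofE.
by exists (perm hinj); apply/forallP => i; rewrite permE hE.
Qed.

Definition srt a : 'S_r := xchoose (srt_subproof a).

Lemma srtE a i : a (srt a i) = interval (wt a) i.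
Proof. by have /forallP/(_ i)/eqP := xchooseP (srt_subproof a). Qed.

End Labels.

(** * Basis elements with arbitrary row labels, their products, and the generators among them *)

Section Elements.
Variables (K : numFieldType) (r k n : nat) (k_gt0 : 0 < k).
Local Notation lab := ('I_r -> 'I_k).
Local Notation interval := Defs.interval.
Local Notation A := (partalg K r n).
Local Notation mp := (MP K r n k_gt0).
Local Notation single := (@mp_single K r k n k_gt0).
Implicit Types (a b d : lab) (w : wcomp r k) (P Q : diagram r).
Local Open Scope ring_scope.

Lemma dbasis_relab (s t : 'S_r) P :
  dbasis K n (relab s t P) =
  dbasis K n (perm_diagram s^-1%g) * dbasis K n P * dbasis K n (perm_diagram t).
Proof.
rewrite dbasisM; have [-> ->] := compose_permdl s^-1%g P.
rewrite expr0 scale1r dbasisM; have [-> ->] := compose_permdr t (relab s^-1%g^-1%g 1%g P).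
by rewrite expr0 scale1r relabM invgK mulg1 mul1g.
Qed.

Lemma symm_perml w (s : 'S_r) : s \in young w ->
  symm K n w * dbasis K n (perm_diagram s) = symm K n w.
Proof.
move=> sw; rewrite /symm -scalerAl mulr_suml; congr (_ *: _).
rewrite [RHS](reindex_inj (mulgI s)) /=.
by apply: eq_big => [t|t _]; [rewrite groupMl | rewrite dbasis_perm].
Qed.

Lemma symm_permr w (s : 'S_r) : s \in young w ->
  dbasis K n (perm_diagram s) * symm K n w = symm K n w.
Proof.
move=> sw; rewrite /symm -scalerAr mulr_sumr; congr (_ *: _).
rewrite [RHS](reindex_inj (mulIg s)) /=.
by apply: eq_big => [t|t _]; [rewrite groupMr | rewrite dbasis_perm].
Qed.

Lemma single_symm w w' (phi psi : A) :
  symm K n w * phi * symm K n w' = symm K n w * psi * symm K n w' ->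
  single w w' phi = single w w' psi.
Proof. by move=> e; apply: mp_eq => c d; rewrite !ffunE /= e. Qed.

Lemma single_linear w w' (c : K) (phi psi : A) :
  single w w' (c *: phi + psi) = c *: single w w' phi + single w w' psi.
Proof.
apply: mp_eq => x y; rewrite -[mpval (_ + _)]/(val (_ + _)) linearP !ffunE /=.
case: ifP => _; last by rewrite [_ *: 0]scaler0 addr0.
rewrite mulrDr mulrDl -(scalerAr c (symm K n w) phi).
by rewrite -(scalerAl c (symm K n w * phi)).
Qed.
HB.instance Definition _ w w' := GRing.isLinear.Build K A mp _ (single w w')
  (@single_linear w w').

Lemma single_relab w w' (s t : 'S_r) P : s \in young w -> t \in young w' ->
  single w w' (dbasis K n (relab s t P)) = single w w' (dbasis K n P).
Proof.
move=> sw tw; apply: single_symm; rewrite dbasis_relab.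
have sandwich (S : pzRingType) (u x y z v : S) : u * (x * y * z) * v = u * x * y * (z * v).
  by rewrite !mulrA.
rewrite sandwich.
have swV : (s^-1 \in young w)%g by rewrite groupV.
by rewrite (symm_perml swV) (symm_permr tw).
Qed.

(** The painted algebra only has labellings by consecutive intervals, so both rows are sorted
    first. *)
Definition el a b P : mp :=
  single (wt a) (wt b) (dbasis K n (relab (srt a) (srt b) P)).

(** Two ways of sorting a row differ by an element of the Young subgroup, which the symmetrizer
    absorbs ([single_relab]). *)
Lemma el_iso a b P a' b' Q : iso a b P a' b' Q -> el a b P = el a' b' Q.
Proof.
case=> s [t [sE tE <-]].
have yE c c' (u : 'S_r) : c' \o u =1 c -> (srt c * u * (srt c')^-1)%g \in young (wt c').
  move=> uE; rewrite inE; apply/forallP => i; apply/eqP.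
  by rewrite !permM -srtE permKV -[LHS]/((c' \o u) _) uE srtE (wt_perm uE).
rewrite /el relabM (wt_perm sE) (wt_perm tE).
rewrite -[RHS](single_relab _ (yE _ _ _ _ sE) (yE _ _ _ _ tE)) relabM.
by rewrite -!mulgA !mulVg !mulg1.
Qed.

Lemma el_interval w w' P : el (interval w) (interval w') P = single w w' (dbasis K n P).
Proof.
have yE v : srt (interval v) \in young v.
  by rewrite inE; apply/forallP => i; rewrite srtE wt_interval.
by rewrite /el !wt_interval single_relab.
Qed.

(** The inverse of the Young permutation [s], carried back from the sorted row to the labelling [b],
    which it preserves ([conj_srtE]). *)
Definition conj_srt b (s : 'S_r) : 'S_r := ((srt b)^-1 * (s^-1 * srt b))%g.

Lemma conj_srtE b (s : 'S_r) : s \in young (wt b) -> b \o conj_srt b s =1 b.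
Proof.
rewrite -groupV inE => /forallP sb i; rewrite /= !permM srtE (eqP (sb _)).
by rewrite -srtE permKV.
Qed.

(** Expanding the middle symmetrizer gives one term per Young permutation; the factor on the left
    clears its denominator. *)
Lemma el_mul a b d P Q :
  #|young (wt b)|%:R *: (el a b P * el b d Q) =
  \sum_(s in young (wt b)) n%:R ^+ nb_middle P (relab (conj_srt b s) 1%g Q) *:
     el a d (compose P (relab (conj_srt b s) 1%g Q)).
Proof.
rewrite /el mp_singleM eqxx -linearZ /= {1}/symm -scalerAr -scalerAl scalerA.
rewrite mulfV ?scale1r; last by rewrite pnatr_eq0 -lt0n cardG_gt0.
rewrite mulr_sumr mulr_suml linear_sum; apply: eq_bigr => s _ /=.
rewrite -mulrA dbasisM; have [-> ->] := compose_permdl s (relab (srt b) (srt d) Q).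
rewrite expr0 scale1r relabM dbasisM linearZ /= mul1g.
have [-> ->] := compose_relab (srt a) (srt b) (s^-1 * srt b)%g (srt d) P Q.
by [].
Qed.

Lemma el_span (B : {pred mp}) : submod_closed B ->
  (forall a b P, el a b P \in B) -> forall x, x \in B.
Proof.
move=> [B0 Bl] Be x.
have BD u v : u \in B -> v \in B -> u + v \in B.
  by move=> uB vB; rewrite -[u]scale1r Bl.
have -> : x = \sum_ab single ab.1 ab.2 (mpval x ab).
  apply: mp_eq => a b; rewrite -[mpval (\sum_i _)]/(val _) raddf_sum sum_ffunE.
  rewrite (bigD1 (a, b)) //= big1 ?addr0 => [|[c d] /negPf cd]; last first.
    by rewrite ffunE /= eq_sym cd.
  by rewrite ffunE /= eqxx (corner_mull (mpP x a b)) (corner_mulr (mpP x a b)).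
apply: (big_ind (fun u => u \in B)) => // -[a b] _ /=.
rewrite [mpval x _]partalgE linear_sum; apply: (big_ind (fun u => u \in B)) => // P _ /=.
by rewrite linearZ /= -[X in X \in B]addr0 Bl // -el_interval.
Qed.

Lemma mult_kap (f : vertex r -> letter k) P l :
  mult (kap f P) l = #|[pred v | f v == l]|.
Proof.
rewrite mult_seq big_map big_enum /= -sum1_card.
rewrite (partition_big (pblock P) (mem (blocks P))) /= => [|v _]; last exact: pblock_in.
apply: eq_bigr => C CP; rewrite contE -sum1_card; apply: eq_bigl => v.
rewrite !inE andbC; congr andb.
by apply/idP/eqP => [/(pblock_block CP)|<-] //; apply: pblock_self.
Qed.

(** Whatever diagram [dlike] picks is isomorphic to [P], and the sorted form of [P] shows that there
    is one to pick. *)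
Lemma dlike_el (X : mpart r k) a b P :
  kap (llab a b) P = mblocks X -> dlike K n k_gt0 X = el a b P.
Proof.
move=> hX.
have ua : unbarred X = wt a.
  apply: wcomp_eq => m; rewrite !wcomp_ofE -hX mult_kap.
  rewrite -[RHS](card_imset _ (@inl_inj 'I_r 'I_r)); apply: eq_card => -[i|i]; rewrite !inE.
    by rewrite (mem_imset _ _ (@inl_inj _ _)) inE (inj_eq (@inl_inj _ _)).
  by apply/esym/negP => /imsetP[].
have ub : barred X = wt b.
  apply: wcomp_eq => m; rewrite !wcomp_ofE -hX mult_kap.
  rewrite -[RHS](card_imset _ (@inr_inj 'I_r 'I_r)); apply: eq_card => -[i|i]; rewrite !inE.
    by apply/esym/negP => /imsetP[].
  by rewrite (mem_imset _ _ (@inr_inj _ _)) inE (inj_eq (@inr_inj _ _)).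
have abP : kap (llab (interval (wt a)) (interval (wt b))) (relab (srt a) (srt b) P) =
    mblocks X.
  rewrite -hX; apply: iso_kap; exists (srt a), (srt b).
  by split=> // i; rewrite /= srtE.
rewrite /dlike ua ub; case: pickP => [Q /eqP hQ|/(_ (relab (srt a) (srt b) P))].
  rewrite -el_interval; apply/el_iso/kap_iso.
  by rewrite -hX in hQ.
by move/eqP; rewrite -[kappa _ _ _]/(kap _ _) => /(_ abP).
Qed.

Lemma kap_seq (f : vertex r -> letter k) P (s : seq {set vertex r}) :
  perm_eq (enum (blocks P)) s -> kap f P = seq_mset (map (cont f) s).
Proof. by move=> Ps; apply/eq_seq_msetP/perm_map. Qed.

Lemma perm_copies (T : eqType) (S : {set 'I_r}) a (g : 'I_k -> T) (c : 'I_k -> nat) :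
  (forall m, c m = #|[pred i in S | a i == m]|) ->
  perm_eq [seq g (a i) | i <- enum S] (copies c g).
Proof.
move=> cE; apply/allP => M _; apply/eqP; rewrite /= count_copies count_map.
rewrite -size_filter -sum1_size big_filter big_enum_cond /=.
rewrite (partition_big a xpredT) //=; apply: eq_bigr => m _.
rewrite cE -sum1_card big_distrl /= [RHS]big_mkcond /= [LHS]big_mkcond.
apply: eq_bigr => i _; rewrite inE.
by case: (i \in S); case: (a i =P m) => [<-|_]; rewrite ?andbF ?andbT ?mul1n //=; case: eqP.
Qed.

Lemma cont_pair a b i j : a i = b j ->
  cont (llab a b) [set inl i; inr j] = [mset inl (a i); inr (a i)]%mset.
Proof.
move=> ij; have pE : perm_eq (enum [set inl i; inr j]) [:: inl i : vertex r; inr j].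
  by apply: uniq_perm; rewrite ?enum_uniq // => v; rewrite mem_enum !inE.
apply/msetP => l; rewrite mset_seqE (seq.permP (perm_map _ pE)) /= -ij addn0.
by rewrite mset1DE msetnE eq_sym [inr _ == _]eq_sym; case: (l == inr _).
Qed.

(** The bars pair the top vertices outside [C] with the bottom vertices outside [C]. Hence [C] has
    equally many of each, as the big block of a generator must. *)
Lemma R_el (r_gt0 : (0 < r)%N) a b P (C : {set vertex r}) :
  C \in blocks P ->
  (forall D, D \in blocks P -> D != C -> exists i j, D = [set inl i; inr j] /\ a i = b j) ->
  Theta r_gt0 (el a b P).
Proof.
move=> CP hP; right.
pose T := [set i | inl i \in C]; pose U := [set j | inr j \in C].
have PT i : i \in ~: T -> exists2 j, pblock P (inl i) = [set inl i; inr j] & a i = b j.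
  rewrite !inE => iC; have [|i' [j [e ab]]] := hP _ (pblock_in P (inl i)).
    by apply: contraNneq iC => <-; apply: pblock_self.
  have := pblock_self P (inl i); rewrite e !inE orbF => /eqP[ii'].
  by exists j; rewrite ?ii'.
have PU j : j \in ~: U -> exists i, pblock P (inr j) = [set inl i; inr j].
  rewrite !inE => jC; have [|i [j' [e ab]]] := hP _ (pblock_in P (inr j)).
    by apply: contraNneq jC => <-; apply: pblock_self.
  have := pblock_self P (inr j); rewrite e !inE /= => /eqP[jj'].
  by exists i; rewrite jj'.
have pT i : i \in ~: T -> pblock P (inl i) != C.
  by rewrite !inE; apply: contraNneq => <-; apply: pblock_self.
have pU i : i \in ~: U -> pblock P (inr i) != C.
  by rewrite !inE; apply: contraNneq => <-; apply: pblock_self.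
have Tinj : {in ~: T &, injective (fun i => pblock P (inl i))}.
  move=> i i' /PT[j e _] _ ii'; have := pblock_self P (inl i').
  by rewrite -ii' e !inE orbF => /eqP[].
have Uinj : {in ~: U &, injective (fun i => pblock P (inr i))}.
  move=> i i' /PU[j e] _ ii'; have := pblock_self P (inr i').
  by rewrite -ii' e !inE => /eqP[].
have Tim : [set pblock P (inl i) | i in ~: T] = blocks P :\ C.
  apply/setP => D; rewrite in_setD1; apply/imsetP/andP => [[i iT ->]|[DC DP]].
    by rewrite pT ?pblock_in.
  have [i [j [e _]]] := hP _ DP DC; have iD : inl i \in D by rewrite e !inE eqxx.
  exists i; last by rewrite (pblock_block DP iD).
  by rewrite !inE; apply: contra DC => iC; rewrite (block_disjoint DP CP iD iC).
have Uim : [set pblock P (inr i) | i in ~: U] = blocks P :\ C.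
  apply/setP => D; rewrite in_setD1; apply/imsetP/andP => [[i iT ->]|[DC DP]].
    by rewrite pU ?pblock_in.
  have [i [j [e _]]] := hP _ DP DC; have iD : inr j \in D by rewrite e !inE eqxx.
  exists j; last by rewrite (pblock_block DP iD).
  by rewrite !inE; apply: contra DC => iC; rewrite (block_disjoint DP CP iD iC).
have TU : #|T| = #|U|.
  apply/eqP; rewrite -(eqn_add2r #|~: T|) cardsC.
  by rewrite -(card_in_imset Tinj) Tim -Uim (card_in_imset Uinj) cardsC.
have sumE (S : {set 'I_r}) (f : lab) : (\sum_m #|[pred i in S | f i == m]| = #|S|)%N.
  rewrite -[RHS]sum1_card (partition_big f xpredT) //=.
  by apply: eq_bigr => m _; rewrite sum1_card.
have hi : (0 < #|T| <= r)%N.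
  apply/andP; split.
    have [[j|j] jC] := set0Pn _ (block_neq0 CP).
      by apply/card_gt0P; exists j; rewrite inE.
    by rewrite TU; apply/card_gt0P; exists j; rewrite inE.
  by rewrite -[X in (_ <= X)%N]card_ord max_card.
pose a' : wcomp #|T| k := wcomp_of (sumE T a).
pose b' : wcomp #|T| k := wcomp_of (etrans (sumE U b) (esym TU)).
have cE : #|~: T| = (r - #|T|)%N by rewrite cardsCs setCK card_ord.
pose c : wcomp (r - #|T|) k := wcomp_of (etrans (sumE (~: T) a) cE).
exists #|T|, hi, a', b', c; apply/esym/dlike_el; rewrite /= /R_blocks.
rewrite (@kap_seq _ _ (C :: [seq pblock P (inl i) | i <- enum (~: T)])); last first.
  apply: uniq_perm; rewrite ?enum_uniq //=.
    apply/andP; split; first by apply/negP => /mapP[i]; rewrite mem_enum => /pT/eqP/nesym.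
    by rewrite map_inj_in_uniq ?enum_uniq // => i j; rewrite !mem_enum; apply: Tinj.
  move=> D; rewrite mem_enum inE; have := congr1 (fun X => D \in pred_of_set X) Tim.
  rewrite in_setD1; case: (D =P C) => [->|_] /=; first by rewrite CP.
  move=> <-.
  by apply/imsetP/mapP => -[i iT ->]; exists i; rewrite ?mem_enum // -mem_enum.
rewrite map_cons; have -> : cont (llab a b) C = big_block a' b'.
  apply/msetP => -[m|m]; rewrite contE ?big_blockl ?big_blockr wcomp_ofE.
    rewrite -[RHS](card_imset _ (@inl_inj 'I_r 'I_r)); apply: eq_card => -[i|i]; rewrite !inE.
      by rewrite (mem_imset _ _ (@inl_inj _ _)) !inE (inj_eq (@inl_inj _ _)).
    by rewrite andbF; apply/esym/negP => /imsetP[].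
  rewrite -[RHS](card_imset _ (@inr_inj 'I_r 'I_r)); apply: eq_card => -[i|i]; rewrite !inE.
    by rewrite andbF; apply/esym/negP => /imsetP[].
  by rewrite (mem_imset _ _ (@inr_inj _ _)) !inE (inj_eq (@inr_inj _ _)).
apply/eq_seq_msetP; rewrite perm_cons -map_comp.
have -> : [seq (cont (llab a b) \o (fun i => pblock P (inl i))) i | i <- enum (~: T)] =
    [seq [mset inl (a i); inr (a i)]%mset | i <- enum (~: T)].
  apply/eq_in_map => i; rewrite mem_enum => /PT[j e ab] /=.
  by rewrite e cont_pair.
by apply: (@perm_copies _ _ _ (fun m => [mset inl m; inr m]%mset)) => m; rewrite wcomp_ofE.
Qed.

Lemma P_el (r_gt0 : (0 < r)%N) b i : Theta r_gt0 (el b b (knife i)).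
Proof.
left; have sumE : (\sum_m #|[pred j in ~: [set i] | b j == m]| = r.-1)%N.
  transitivity #|~: [set i]|; last by rewrite cardsC1 card_ord.
  rewrite -[RHS]sum1_card (partition_big b xpredT) //=.
  by apply: eq_bigr => m _; rewrite sum1_card.
exists (b i), (b i), (wcomp_of sumE); apply/esym/dlike_el; rewrite /= /P_blocks.
have pE j : j != i -> pblock (knife i) (inl j) = [set inl j; inr j].
  move=> ji; apply/setP => v; rewrite mem_pblockE same_kerd !inE /= (negPf ji).
  have inE1 l l' : (inl l == inl l' :> vertex r) = (l == l') by apply: inj_eq => ? ? [].
  have inE2 l l' : (inr l == inr l' :> vertex r) = (l == l') by apply: inj_eq => ? ? [].
  have inE3 l l' : (inr l == inr l' :> vertex r + 'I_r) = (l == l').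
    by apply: inj_eq => ? ? [].
  case: v => l; rewrite ?inE1 ?inE2 ?orbF /=; case: (l =P i) => [->|_];
    by rewrite ?inE3 [RHS]eq_sym ?(negPf ji).
have lE : pblock (knife i) (inl i) = [set inl i].
  apply/setP => v; rewrite mem_pblockE same_kerd !inE /= eqxx.
  case: v => l /=; case: (l =P i) => [->|/eqP li];
    by rewrite ?eqxx ?(inj_eq (@inl_inj _ _)) ?(negPf li).
have rE : pblock (knife i) (inr i) = [set inr i].
  apply/setP => v; rewrite mem_pblockE same_kerd !inE /= eqxx.
  case: v => l /=; case: (l =P i) => [->|/eqP li];
    by rewrite ?eqxx ?(inj_eq (@inr_inj _ _)) ?(negPf li).
rewrite (@kap_seq _ _ ([set inl i] :: [set inr i] ::
    [seq [set inl j; inr j] | j <- enum (~: [set i])])); last first.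
  apply: uniq_perm; [exact: enum_uniq | rewrite /= | ].
    rewrite in_cons (inj_eq set1_inj) /=; apply/and3P; split.
    - by apply/negP => /mapP[j _ /setP/(_ (inr j))]; rewrite !inE eqxx orbT.
    - by apply/negP => /mapP[j _ /setP/(_ (inl j))]; rewrite !inE eqxx.
    rewrite map_inj_uniq ?enum_uniq // => j l /setP/(_ (inl j)).
    by rewrite !inE eqxx /= orbF => /esym/eqP[].
  move=> D; rewrite mem_enum !in_cons; apply/blockP/or3P => [[u ->]|[/eqP->|/eqP->|/mapP[j]]].
  - have [ui|ui] := eqVneq (idx u) i.
      case: u ui => u /= ->; [constructor 1; rewrite lE | constructor 2; rewrite rE]; exact: eqxx.
    constructor 3; apply/mapP; exists (idx u); first by rewrite mem_enum !inE.
    rewrite -pE //; apply/eqP; rewrite -[_ == _]/(same_block _ _ _) same_kerd /= (negPf ui).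
    exact: eqxx.
  - by exists (inl i).
  - by exists (inr i).
  - by rewrite mem_enum !inE => ji ->; exists (inl j); rewrite pE.
have c1 v : cont (llab b b) [set v] = [mset (llab b b v)]%mset.
  by apply/msetP => l; rewrite mset_seqE enum_set1 /= addn0 msetnE eq_sym; case: eqP.
rewrite /= !c1; apply/eq_seq_msetP; rewrite /= !perm_cons -map_comp.
have -> : [seq (cont (llab b b) \o (fun j => [set inl j; inr j])) j | j <- enum (~: [set i])] =
    [seq [mset inl (b j); inr (b j)]%mset | j <- enum (~: [set i])].
  by apply: eq_map => j /=; rewrite cont_pair.
by apply: (@perm_copies _ _ _ (fun m => [mset inl m; inr m]%mset)) => m; rewrite wcomp_ofE.
Qed.

End Elements.

(** * Blocks of melded, cut and flipped diagrams *)

Section Merging.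
Variable r : nat.
Implicit Types (P : diagram r) (S : {set 'I_r}) (C D X : {set vertex r}).

Definition hit S X := [exists j in S, inr j \in X].

Lemma hitP S X : reflect (exists2 j, j \in S & inr j \in X) (hit S X).
Proof. by apply: (iffP existsP) => [[j /andP[]]|[j jS jX]]; exists j => //; apply/andP. Qed.

Definition merged P S : {set vertex r} := [set v | hit S (pblock P v)].

Lemma pblock_meld P S u :
  pblock (meld P S) u = if hit S (pblock P u) then merged P S else pblock P u.
Proof.
apply/setP => v; rewrite mem_pblockE same_kerd -!/(hit _ _).
case: ifP => hu; last rewrite mem_pblockE.
  by rewrite inE; case: ifP.
case: ifP => hv; last by rewrite (inj_eq Some_inj).
apply/esym/negP => /eqP uv.
by rewrite uv hv in hu.
Qed.

Lemma merged_in P S j : j \in S -> merged P S \in blocks (meld P S).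
Proof.
move=> jS; apply/blockP; exists (inr j); rewrite pblock_meld ifT //.
by apply/hitP; exists j => //; apply: pblock_self.
Qed.

Lemma meld_unhit P S C : C \in blocks P -> ~~ hit S C -> C \in blocks (meld P S).
Proof.
by case/blockP => u -> /negPf h; apply/blockP; exists u; rewrite pblock_meld h.
Qed.

Lemma meld_block P S C : C \in blocks (meld P S) ->
  C = merged P S \/ C \in blocks P /\ ~~ hit S C.
Proof.
case/blockP => u ->; rewrite pblock_meld; case: ifP => h; first by left.
by right; rewrite pblock_in h.
Qed.

Lemma merged_neq P S C : C \in blocks P -> ~~ hit S C -> C != merged P S.
Proof.
move=> CP hC; have [u uC] := set0Pn _ (block_neq0 CP).
apply: contraNneq hC => CU; move: (uC); rewrite {1}CU inE.
by rewrite (pblock_block CP uC).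
Qed.

Lemma pblock_cut P i u :
  pblock (cut P i) u = if u == inr i then [set inr i] else pblock P u :\ inr i.
Proof.
apply/setP => v; rewrite mem_pblockE same_kerd; case: (eqVneq u (inr i)) => [_|ui].
  by rewrite inE; case: (v =P inr i).
rewrite in_setD1; case: (v =P inr i) => [//|_] /=.
by rewrite mem_pblockE (inj_eq Some_inj).
Qed.

Lemma flip_imsetK : involutive (fun X : {set vertex r} => flipv @: X).
Proof.
move=> X; rewrite -imset_comp -[RHS]imset_id; apply: eq_imset => u.
exact: flipvK.
Qed.

Lemma pblock_flip P u : pblock (flip P) u = flipv @: pblock P (flipv u).
Proof.
apply/setP => v; rewrite mem_pblockE same_flip -{2}[v]flipvK.
by rewrite (mem_imset _ _ (inv_inj (@flipvK r))) mem_pblockE.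
Qed.

Lemma flip_block P C : (flipv @: C \in blocks (flip P)) = (C \in blocks P).
Proof.
apply/blockP/blockP => -[u CE].
  exists (flipv u); apply: (imset_inj (inv_inj (@flipvK r))).
  by rewrite CE pblock_flip.
by exists (flipv u); rewrite pblock_flip flipvK CE.
Qed.

Lemma flip_knife i : flip (knife i : diagram r) = knife i.
Proof.
have idxf w : idx (flipv w) = idx w by case: w.
apply: diagram_eq => u v; rewrite same_flip !same_kerd !idxf.
case: ifP => _; case: ifP => _ //; rewrite !(inj_eq inl_inj).
by rewrite (inj_eq (inv_inj (@flipvK r))).
Qed.

End Merging.

Section Trivial.
Variables r k : nat.
Local Notation lab := ('I_r -> 'I_k).
Implicit Types (a b d : lab) (P : diagram r) (S : {set 'I_r}) (A C X : {set vertex r}).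

(** A two-vertex column counts only if its labels match, so triviality depends on the labelling as
    well as on the diagram. *)
Definition triv a b X : bool :=
  (#|X| == 1) || [exists i, exists j, (X == [set inl i; inr j]) && (a i == b j)].

Lemma trivP a b X : reflect ((exists u, X = [set u]) \/
  exists i j, X = [set inl i; inr j] /\ a i = b j) (triv a b X).
Proof.
apply: (iffP orP) => -[].
- by move/cards1P; left.
- by case/existsP => i /existsP[j /andP[/eqP-> /eqP ab]]; right; exists i, j.
- by case=> u ->; left; rewrite cards1.
- case=> i [j [-> ab]]; right; apply/existsP; exists i; apply/existsP; exists j.
  by rewrite eqxx ab /=.
Qed.

Lemma triv_ext a b d X : (forall j, inr j \in X -> b j = d j) ->
  triv a b X = triv a d X.
Proof.
move=> bd; apply/trivP/trivP => -[[u ->]|[i [j [XE ab]]]]; try by left; exists u.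
  by right; exists i, j; split=> //; rewrite -bd // XE !inE eqxx orbT.
by right; exists i, j; split=> //; rewrite bd // XE !inE eqxx orbT.
Qed.

Lemma triv_del a b X u : triv a b X -> X :\ u != set0 -> triv a b (X :\ u).
Proof.
move=> tX; have [uX|uX] := boolP (u \in X); last first.
  by have -> : X :\ u = X by apply/eqP; rewrite eqEsubset subsetDl subsetD1 subxx.
have X2 : #|X| <= 2 by case/trivP: tX => [[v ->]|[i [j [-> _]]]]; rewrite ?cards1 // cards2.
rewrite -card_gt0 => X0; apply/orP; left; rewrite eqn_leq X0 andbT.
by move: X2; rewrite (cardsD1 u X) uX.
Qed.

Lemma triv_flip a b X : triv b a (flipv @: X) = triv a b X.
Proof.
rewrite /triv (card_imset _ (inv_inj (@flipvK r))); congr (_ || _).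
have fE i j : flipv @: [set inl i; inr j] = [set inl j; inr i] :> {set vertex r}.
  by rewrite imsetU1 imset_set1 setUC.
have e (Y Z : {set vertex r}) : (flipv @: Y == flipv @: Z :> {set vertex r}) = (Y == Z).
  by rewrite (inj_eq (imset_inj (inv_inj (@flipvK r)))).
apply/existsP/existsP => -[i /existsP[j /andP[/eqP XE ab]]]; exists j; apply/existsP; exists i.
  by rewrite [a j == _]eq_sym ab andbT -e fE XE.
by rewrite [b j == _]eq_sym ab andbT XE fE.
Qed.

Definition nt a b P A : {set {set vertex r}} :=
  [set C in blocks P | (C != A) && ~~ triv a b C].

Lemma nt_flip a b P A :
  nt b a (flip P) (flipv @: A) = (fun X : {set vertex r} => flipv @: X) @: nt a b P A.
Proof.
have finj := imset_inj (inv_inj (@flipvK r)).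
apply/setP => X; rewrite -[X]flip_imsetK; set Y := flipv @: X.
by rewrite (mem_imset _ _ finj) !inE flip_block triv_flip (inj_eq finj).
Qed.

End Trivial.

(** * Multiset partitions of melded diagrams *)

Section MeldContent.
Variables r k : nat.
Local Notation lab := ('I_r -> 'I_k).
Implicit Types (a b d : lab) (P : diagram r) (S : {set 'I_r}) (A C X : {set vertex r}).

Lemma cont_ext a b d X : (forall j, inr j \in X -> b j = d j) ->
  cont (llab a b) X = cont (llab a d) X.
Proof.
move=> bd; apply/msetP => l; rewrite !contE; apply: eq_card => v; rewrite !inE.
by case: (boolP (v \in X)) => //; case: v => j //= jX; rewrite bd.
Qed.

Definition lone P j : bool := pblock P (inr j) == [set inr j].

Lemma triv_block a b P j : triv a b (pblock P (inr j)) ->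
  lone P j \/ exists2 i, pblock P (inr j) = [set inl i; inr j] & a i = b j.
Proof.
have jj := pblock_self P (inr j); case/trivP => [[u e]|[i [l [e ab]]]].
  by left; rewrite /lone e; move: jj; rewrite e inE => /eqP ->.
right; exists i; move: jj; rewrite e !inE /= => /eqP[->] //.
Qed.

Lemma triv_block_inj a b P S :
  (forall j, j \in S -> triv a b (pblock P (inr j))) ->
  {in S &, injective (fun j => pblock P (inr j))}.
Proof.
move=> tS j j' /tS tj _ jj'; have := pblock_self P (inr j'); rewrite -jj'.
by case: (triv_block tj) => [/eqP ->|[i -> _]]; rewrite !inE => /eqP[].
Qed.

(** The top label of a bar equals [b j], so the content sees the block only through the labels at
    [j] and through whether [j] is lone. *)
Lemma cont_triv a b d P j l : triv a b (pblock P (inr j)) ->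
  cont (llab a d) (pblock P (inr j)) l =
    (~~ lone P j && (inl (b j) == l)) + (inr (d j) == l).
Proof.
rewrite contE; case/triv_block => [hj|[i e ab]].
  rewrite hj /= add0n; move/eqP: hj => ->.
  case: eqP => [jl|jl].
    by rewrite -[RHS](cards1 (inr j : vertex r)); apply: eq_card => v;
      rewrite !inE andbC; case: (v =P inr j) => [->|_]; rewrite ?andbF ?andbT //= jl eqxx.
  by apply: eq_card0 => v; rewrite !inE; case: (v =P inr j) => [->|_] //=; apply/eqP.
have -> : lone P j = false.
  by apply/negP => /eqP; rewrite e => /setP/(_ (inl i)); rewrite !inE eqxx.
rewrite /= -ab -[(inl (a i) == l) : nat]/((llab a d (inl i) == l) : nat).
rewrite -[(inr (d j) == l) : nat]/((llab a d (inr j) == l) : nat) e.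
rewrite -sum1_card big_mkcond /= (bigD1 (inl i)) //= (bigD1 (inr j)) //=.
rewrite !inE !eqxx orbT /= big1 ?addn0 => [|v /andP[/negPf vi /negPf vj]].
  by case: eqP; case: eqP.
by rewrite !inE vi vj.
Qed.

(** Melding trades the hit blocks for the merged one, and the unhit blocks keep their content
    because labels change only on [S]. The sums on both sides avoid a subtraction in [nat]. *)
Lemma meld_count a b d P S (M : {mset letter k}) j0 : j0 \in S ->
  (forall j, j \notin S -> b j = d j) ->
  (forall j, j \in S -> triv a b (pblock P (inr j))) ->
  kap (llab a d) (meld P S) M + \sum_(j in S) (cont (llab a b) (pblock P (inr j)) == M) =
  (cont (llab a d) (merged P S) == M) + kap (llab a b) P M.
Proof.
move=> j0S bd tS; rewrite !kapE.
pose f := llab a b; pose g := llab a d; pose U := merged P S.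
pose pb j := pblock P (inr j).
pose unhit := [set B in blocks P | ~~ hit S B & cont f B == M].
have uE B : B \in blocks P -> ~~ hit S B -> cont g B = cont f B.
  move=> BP hB; apply/esym/cont_ext => j jB; apply: bd.
  by apply: contra hB => jS; apply/hitP; exists j.
have pbinj : {in S &, injective pb} := triv_block_inj tS.
have -> : \sum_(j in S) (cont f (pb j) == M) = #|[set B in blocks P | hit S B & cont f B == M]|.
  transitivity #|pb @: [set j in S | cont f (pb j) == M]|.
    rewrite card_in_imset => [|j j']; last first.
      by rewrite !inE => /andP[jS _] /andP[j'S _]; apply: pbinj.
    by rewrite -sum1dep_card big_mkcondr; apply: eq_bigr => j _; case: eqP.
  apply: eq_card => B; rewrite inE; apply/imsetP/and3P => [[j]|[BP /hitP[j jS jB] cB]].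
    rewrite inE => /andP[jS cj] ->; rewrite pblock_in cj; split=> //.
    by apply/hitP; exists j => //; apply: pblock_self.
  by exists j; rewrite ?inE ?jS /pb (pblock_block BP jB).
have -> : #|[pred B in blocks P | cont f B == M]| =
    #|[set B in blocks P | hit S B & cont f B == M]| + #|unhit|.
  rewrite -cardsUI [X in _ = _ + X]eq_card0 => [|B]; last first.
    by rewrite !inE; case: hit; rewrite ?andbF.
  rewrite addn0; apply: eq_card => B; rewrite !inE.
  by case: (B \in blocks P); case: hit; rewrite ?orbF.
have -> : #|[pred B in blocks (meld P S) | cont g B == M]| = (cont g U == M) + #|unhit|.
  have UN : U \notin unhit.
    apply/negP; rewrite inE => /and3P[UP hU _].
    by have := merged_neq UP hU; rewrite eqxx.
  have uM B : B \in unhit -> (B \in blocks (meld P S)) && (cont g B == M).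
    by rewrite inE => /and3P[BP hB cB]; rewrite meld_unhit // uE.
  have Mu B : B \in blocks (meld P S) -> cont g B == M -> B = U \/ B \in unhit.
    by move/meld_block => [->|[BP hB] cB]; [left|right; rewrite inE BP hB -uE].
  case: (boolP (cont g U == M)) => cU; last first.
    rewrite add0n; apply: eq_card => B; rewrite [LHS]inE /=; apply/andP/idP => [[BP cB]|/uM/andP//].
    by case: (Mu _ BP cB) => // BU; rewrite BU in cB; rewrite cB in cU.
  transitivity #|U |: unhit|; last by rewrite cardsU1 UN.
  apply: eq_card => B; rewrite inE /= in_setU1.
  apply/andP/orP => [[BP cB]|[/eqP->|/uM/andP//]].
    by case: (Mu _ BP cB) => [->|]; [left|right].
  by rewrite cU (merged_in _ j0S).
by rewrite addnA addnAC.
Qed.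

Lemma cont_merged a b d P S l :
  (forall j, j \in S -> triv a b (pblock P (inr j))) ->
  cont (llab a d) (merged P S) l =
    \sum_(j in S) (~~ lone P j && (inl (b j) == l)) + \sum_(j in S) (inr (d j) == l).
Proof.
move=> tS; rewrite -big_split /=.
pose pb j := pblock P (inr j).
have pbinj : {in S &, injective pb} := triv_block_inj tS.
under eq_bigr => j jS do rewrite -(cont_triv d l (tS j jS)) contE.
have cE v : v \in merged P S -> exists2 j, j \in S & pblock P v = pb j.
  rewrite inE => /hitP[j jS jv]; exists j => //.
  by rewrite /pb (pblock_block (pblock_in P v) jv).
rewrite contE -sum1_card.
rewrite (partition_big (pblock P) (mem (pb @: S))) /= => [|v]; last first.
  by rewrite inE => /andP[/cE[j jS ->] _]; apply: imset_f.
rewrite big_imset //=; apply: eq_bigr => j jS; rewrite -sum1_card.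
apply: eq_bigl => v; rewrite !inE; apply/andP/andP => [[/andP[_ ->] /eqP e]|[vj ->]].
  by have := pblock_self P v; rewrite e.
have e : pblock P v = pb j by rewrite (pblock_block (pblock_in P (inr j)) vj).
rewrite e eqxx andbT; split=> //; apply/hitP; exists j => //; exact: pblock_self.
Qed.

(* The two sets S and s^-1 S differ only in which of the bars they hit, so    *)
(* fusing along either one gives the same multiset partition.                 *)
Lemma kap_meld_perm a b d P S (s : 'S_r) j0 : j0 \in S -> b \o s =1 b ->
  (forall j, j \notin S -> b j = d j) ->
  (forall j, j \in S -> triv a b (pblock P (inr j))) ->
  (forall j, j \in s @^-1: S -> triv a b (pblock P (inr j))) ->
  (forall j, lone P j -> (j \in S) = (j \in s @^-1: S)) ->
  kap (llab a (d \o s)) (meld P (s @^-1: S)) = kap (llab a d) (meld P S).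
Proof.
move=> j0S bs bd tS tS' lS.
have reS (F : 'I_r -> nat) : \sum_(j in s @^-1: S) F (s j) = \sum_(j in S) F j.
  rewrite [RHS](reindex_inj (@perm_inj _ s)) /=.
  by apply: eq_bigl => j; rewrite inE.
have reb (F : 'I_k -> nat) : \sum_(j in s @^-1: S) F (b j) = \sum_(j in S) F (b j).
  by rewrite -reS; apply: eq_bigr => j _; rewrite -[in LHS]bs.
(* Loneness is not preserved by [s], so plain reindexing fails. Treating every vertex as a bar gives
   a sum that can be reindexed, and the correction runs over the lone vertices, which are the same
   in both sets. *)
have rel (F : 'I_k -> bool -> nat) : \sum_(j in s @^-1: S) F (b j) (lone P j) =
    \sum_(j in S) F (b j) (lone P j).
  have split T : \sum_(j in T) F (b j) (lone P j) + \sum_(j in T | lone P j) F (b j) false =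
      \sum_(j in T) F (b j) false + \sum_(j in T | lone P j) F (b j) true.
    rewrite !big_mkcondr /= -!big_split; apply: eq_bigr => j _ /=.
    by case: (lone P j); rewrite ?addn0 // addnC.
  have lE G : \sum_(j in s @^-1: S | lone P j) G j = \sum_(j in S | lone P j) G j :> nat.
    by apply: eq_bigl => j; case: (boolP (lone P j)) => [/lS ->|]; rewrite ?andbF.
  apply/eqP; rewrite -(eqn_add2r (\sum_(j in s @^-1: S | lone P j) F (b j) false)).
  by rewrite split lE (reb (F^~ false)) lE split.
apply/msetP => M.
pose G c z : bool := [forall l : letter k, (~~ z && (inl c == l)) + (inr c == l) == M l].
have GE j : triv a b (pblock P (inr j)) ->
    (cont (llab a b) (pblock P (inr j)) == M) = G (b j) (lone P j).
  move=> tj; apply/eqP/forallP => [<- l|h]; first by rewrite (cont_triv b l tj).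
  by apply/msetP => l; rewrite (cont_triv b l tj); apply/eqP/h.
have j0S' : s^-1%g j0 \in s @^-1: S by rewrite inE permKV.
have bd' j : j \notin s @^-1: S -> b j = (d \o s) j.
  by rewrite inE => /bd /= <-; rewrite -[in LHS]bs.
have := meld_count M j0S bd tS; have := meld_count M j0S' bd' tS'.
under eq_bigr => j jS do rewrite (GE _ (tS' j jS)).
rewrite (rel (fun c z => G c z)).
under [X in _ -> _ + X = _ -> _]eq_bigr => j jS do rewrite (GE _ (tS j jS)).
have -> : cont (llab a (d \o s)) (merged P (s @^-1: S)) = cont (llab a d) (merged P S).
  apply/msetP => l; rewrite (cont_merged _ _ tS) (cont_merged _ _ tS').
  by rewrite (rel (fun c z => ~~ z && (inl c == l))) (reS (fun j => inr (d j) == l : nat)).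
by move=> <- /addIn.
Qed.

End MeldContent.

(** * The induction *)

Section Closure.
Variables r k : nat.
Local Notation lab := ('I_r -> 'I_k).
Local Notation diag := (diagram r).
Implicit Types (a b d : lab) (P Q D : diag) (S : {set 'I_r}) (A C X : {set vertex r}).

(** Stated for a predicate on labelled diagrams rather than for a subalgebra, so that the whole
    argument also applies to the mirrored predicate. *)
Record mult_closed (Bel : lab -> lab -> diag -> Prop) : Prop := MultClosed {
  closed_iso : forall a b P a' b' Q, iso a b P a' b' Q -> Bel a' b' Q -> Bel a b P;
  closed_R : forall a b P C, C \in blocks P ->
    (forall X, X \in blocks P -> X != C ->
       exists i j, X = [set inl i; inr j] /\ a i = b j) -> Bel a b P;
  closed_P : forall b i, Bel b b (knife i);
  closed_mul : forall a b d P Q D, Bel a b P -> Bel b d Q ->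
    (nb_middle P Q = 0 /\ compose P Q = D) ->
    (forall s : 'S_r, b \o s =1 b ->
       (nb_middle P (relab s 1%g Q) = 0 /\ iso a d (compose P (relab s 1%g Q)) a d D) \/
       Bel a d (compose P (relab s 1%g Q))) ->
    Bel a d D }.

Definition mirror (Bel : lab -> lab -> diag -> Prop) a b P : Prop := Bel b a (flip P).

(** Flipping reverses products, so the two factors trade places and a middle permutation becomes its
    inverse. *)
Lemma mirror_closed Bel : mult_closed Bel -> mult_closed (mirror Bel).
Proof.
move=> cB; have iso_flip a b P a' b' Q :
    iso a b P a' b' Q -> iso b a (flip P) b' a' (flip Q).
  by case=> s [t [sE tE <-]]; exists t, s; split=> //; rewrite flip_relab.
split.
- by move=> a b P a' b' Q /iso_flip; apply: closed_iso.
- move=> a b P C CP hP; apply: (closed_R cB (C := flipv @: C)).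
    by rewrite flip_block.
  move=> X XP XC; have fK := flip_imsetK X.
  have [||i [j [e ab]]] := hP (flipv @: X).
  + by rewrite -flip_block fK.
  + by apply: contraNneq XC => <-; rewrite fK.
  exists j, i; split=> //; rewrite -fK e.
  by rewrite imsetU1 imset_set1 setUC.
- by move=> b i; rewrite /mirror flip_knife; apply: closed_P.
- move=> a b d P Q D aP bQ [nb0 PQ] hs.
  apply: (closed_mul cB bQ aP) => [|s bs].
    by have [-> ->] := compose_flip P Q; rewrite PQ.
  have bsV : b \o (s^-1)%g =1 b by move=> i; rewrite /= -[LHS]bs /= permKV.
  rewrite -(flip_relab 1%g s P).
  have [-> ->] := compose_flip (relab 1%g s P) Q.
  have := compose_relab 1%g s 1%g 1%g P Q; rewrite relab1 => -[-> ->].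
  rewrite relab1 mulg1; case: (hs _ bsV) => [[h1 h2]|h]; [left|by right].
  by split=> //; apply: iso_flip.
Qed.

Section ClosedRight.
Variable Bel : lab -> lab -> diag -> Prop.
Hypothesis cB : mult_closed Bel.

(** Permuting a knife moves it to a column [i'] with the same label, up to a permutation of the
    bottom row that preserves [b]. *)
Lemma closed_knife a b P i : Bel a b P -> ~~ lone P i ->
  (forall i', b i' = b i ->
     (~~ lone P i' /\ iso a b (cut P i') a b (cut P i)) \/ Bel a b (compose P (knife i'))) ->
  Bel a b (cut P i).
Proof.
move=> aP Pi h; apply: (closed_mul cB aP (closed_P cB b i)).
  exact: compose_knife_cut.
move=> s bs; pose i' := (s^-1)%g i.
have -> : relab s 1%g (knife i) = relab 1%g (s^-1)%g (knife i').
  by rewrite -(relab_knife s i') permKV relabM mul1g mulVg.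
have := compose_relab 1%g 1%g 1%g (s^-1)%g P (knife i').
rewrite relab1 => -[-> ->]; rewrite invg1 mulg1 relab1.
have bi' : b i' = b i by rewrite -[LHS]bs /= permKV.
have isoE Z : iso a b (relab 1%g (s^-1)%g Z) a b Z.
  exists 1%g, (s^-1)%g; split=> // j; rewrite /= ?perm1 //.
  by rewrite -[LHS]bs /= permKV.
case: (h _ bi') => [[Pi' iP]|aPi']; last by right; apply: closed_iso aPi'.
have [-> e] := compose_knife_cut Pi'; left; split=> //.
by rewrite e; apply: iso_trans iP; apply: isoE.
Qed.

(** Permuting a fusion replaces [S] by its preimage; the permutation left over on the bottom row
    turns the labels [d] into [d \o s]. *)
Lemma closed_fuse a b d P S j0 : j0 \in S -> (forall j, j \notin S -> b j = d j) ->
  Bel a b P ->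
  (forall s : 'S_r, b \o s =1 b ->
     iso a (d \o s) (meld P (s @^-1: S)) a d (meld P S) \/
     Bel a (d \o s) (meld P (s @^-1: S))) ->
  Bel a d (meld P S).
Proof.
move=> j0S bd aP h; apply: (closed_mul cB aP (Q := fuse S)).
- pose F := pblock (fuse S) (inl j0).
  apply: (closed_R cB (C := F)) => [|X]; first exact: pblock_in.
  case/blockP => u -> uF; have uS : idx u \notin S.
    apply: contra uF => uS; apply/eqP/eqP; rewrite -[_ == _]/(same_block _ _ _).
    by rewrite same_kerd /= uS j0S.
  exists (idx u), (idx u); split; last exact: bd.
  apply/setP => v; rewrite mem_pblockE same_kerd (negPf uS) !inE.
  have -> : (v == inl (idx u)) || (v == inr (idx u)) = (idx u == idx v).
    by case: v => v; apply/orP/eqP => [[/eqP[]|/eqP[]]|->] //; [left|right].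
  case: ifP => vS; last by rewrite (inj_eq Some_inj).
  by apply/esym/negP => /eqP uv; rewrite -uv (negPf uS) in vS.
- exact: compose_fuse.
move=> s bs; have -> : relab s 1%g (fuse S) = relab 1%g (s^-1)%g (fuse (s @^-1: S)).
  by rewrite -relab_fuse relabM mul1g mulVg.
have := compose_relab 1%g 1%g 1%g (s^-1)%g P (fuse (s @^-1: S)).
rewrite relab1 => -[-> ->]; rewrite invg1 mulg1 relab1.
have [-> ->] := compose_fuse P (s @^-1: S).
have isoE Z : iso a d (relab 1%g (s^-1)%g Z) a (d \o s) Z.
  exists 1%g, (s^-1)%g; split=> // j; rewrite /= ?perm1 //.
  by rewrite permKV.
case: (h s bs) => [i|aP']; [left|right]; last exact: closed_iso (isoE _) aP'.
by split=> //; apply: iso_trans i; apply: isoE.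
Qed.

(** The induction hypothesis: [pr] tells for which pairs, number of nontrivial unmarked blocks and
    size of the marked block, the claim is known. *)
Definition within (Bel' : lab -> lab -> diag -> Prop) (pr : nat -> nat -> Prop) :=
  forall a b P A, A \in blocks P -> pr #|nt a b P A| #|A| -> Bel' a b P.

(* The bottom vertex of a lone block {inr i} is moved into A: multiplying the *)
(* result by a knife detaches one bottom vertex with the same label again,    *)
(* and whenever it comes from another block, A has grown.                     *)
Lemma lone_step N a b P A i : A \in blocks P -> #|nt a b P A| <= N ->
  within Bel (fun x y => x <= N /\ #|A| < y) ->
  lone P i -> A != [set inr i] -> Bel a b P.
Proof.
move=> AP ntA IH Pi Ai.
pose Y : diag := kerd (fun v => if v == inr i then A else pblock P v).
pose U := inr i |: A.
have iA : inr i \notin A.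
  apply: contra Ai => iA; rewrite -(eqP Pi) eq_sym; apply/eqP.
  exact: pblock_block.
have pbA v : (pblock P v == A) = (v \in A).
  by apply/eqP/idP => [<-|/(pblock_block AP)] //; apply: pblock_self.
have pY u : pblock Y u = if u \in U then U else pblock P u.
  apply/setP => v; rewrite mem_pblockE same_kerd.
  have [->|ui] := eqVneq u (inr i).
    rewrite in_setU1 eqxx /= in_setU1.
    by have [->|vi] := eqVneq v (inr i); rewrite /= ?eqxx // eq_sym pbA.
  rewrite in_setU1 (negPf ui) /=; case: (boolP (u \in A)) => [uA|/negPf uA].
    rewrite in_setU1; have [->|vi] := eqVneq v (inr i) => /=.
      by rewrite pbA uA.
    by rewrite (pblock_block AP uA) eq_sym pbA.
  have [->|vi] := eqVneq v (inr i).
    rewrite pbA uA; apply/esym/negP => iu.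
    have e : pblock P (inr i) = pblock P u by rewrite (pblock_block (pblock_in P u) iu).
    have := pblock_self P u; rewrite -e (eqP Pi) inE => ui'.
    by rewrite ui' in ui.
  by rewrite mem_pblockE.
have iU : inr i \in U by rewrite !inE eqxx.
have UY : U \in blocks Y by apply/blockP; exists (inr i); rewrite pY iU.
have cU : #|A| < #|U| by rewrite cardsU1 iA.
have YB C : C \in blocks Y -> C != U -> C \in blocks P /\ C != A.
  case/blockP => u ->; rewrite pY; case: ifP => uU; first by rewrite eqxx.
  by rewrite pblock_in pbA; move: uU; rewrite in_setU1 => /negbT; rewrite negb_or => /andP[].
have aY : Bel a b Y.
  apply: (IH _ _ _ U) => //; split=> //; apply: leq_trans ntA.
  apply/subset_leq_card/subsetP => C; rewrite !inE -!/(_ \in blocks _).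
  by case/and3P => CY CU ->; have [-> ->] := YB _ CY CU.
have nloneU j : inr j \in U -> ~~ lone Y j.
  move=> jU; rewrite /lone pY jU; apply/negP => /eqP e.
  move: cU; rewrite e cards1 ltnS leqn0 cards_eq0 => /eqP A0.
  by have := block_neq0 AP; rewrite A0 eqxx.
have -> : P = cut Y i.
  apply: diagram_eq => u v; rewrite -!mem_pblockE pblock_cut.
  have [->|ui] := eqVneq u (inr i); first by rewrite (eqP Pi).
  rewrite pY in_setU1 (negPf ui) /= in_setD1; have [->|vi] := eqVneq v (inr i).
    rewrite mem_pblockE same_blockC -mem_pblockE (eqP Pi) inE.
    exact: negPf.
  case: ifP => uA //=; rewrite in_setU1 (negPf vi) /=.
  by rewrite (pblock_block AP uA).
apply: closed_knife => // [|i' bi]; first exact: nloneU.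
(* Two bottom vertices of [U] with the same label can be swapped, which carries one cut to the
   other. *)
have [iU'|iU'] := boolP (inr i' \in U).
  left; split; first exact: nloneU.
  exists 1%g, (tperm i i'); split=> [j|j|]; rewrite /= ?perm1 //.
    by case: tpermP => [->|->|].
  pose m := mv 1%g (tperm i i') : vertex r -> vertex r.
  have mE u : (m u == inr i) = (u == inr i').
    case: u => u //=; rewrite !(inj_eq inr_inj).
    by rewrite -[X in _ == X](tpermR i i') (inj_eq perm_inj).
  have mU u : u != m u -> (u \in U) && (m u \in U).
    case: u => u /=; first by rewrite perm1 eqxx.
    case: tpermP => [->|->|]; rewrite ?iU ?iU' //.
    by rewrite eqxx.
  have mY u : pblock Y (m u) = pblock Y u.
    have [<- //|/mU/andP[h1 h2]] := eqVneq u (m u).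
    by rewrite !pY h1 h2.
  by apply: diagram_eq => u v; rewrite same_relab !same_kerd -/(m u) -/(m v) !mE !mY.
(* Outside [U] the knife either returns [Y], when [i'] is lone, or leaves [U], larger than [A], as a
   block. *)
right; have [li|nli] := boolP (lone Y i'); first by rewrite compose_knife_single //; apply/eqP.
have [_ ->] := compose_knife_cut nli.
have UE : U \in blocks (cut Y i').
  apply/blockP; exists (inr i); rewrite pblock_cut pY iU ifF.
    by apply/esym/eqP; rewrite eqEsubset subsetDl subsetD1 subxx.
  by apply: contraNF iU' => /eqP <-.
apply: (IH _ _ _ U) => //; split=> //; apply: leq_trans ntA.
(* A deletion never turns a trivial block into a nontrivial one, so the nontrivial blocks of the cut
   other than [U] come from those of [P] other than [A]. *)
apply: leq_trans (leq_imset_card (fun X => X :\ inr i') _).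
apply/subset_leq_card/subsetP => C; rewrite inE => /and3P[/blockP[u ->]].
rewrite pblock_cut; have [_|ui] := eqVneq u (inr i').
  by rewrite /triv cards1.
move=> XU nX; apply/imsetP; exists (pblock Y u) => //.
have XU' : pblock Y u != U.
  apply: contraNneq XU => ->; apply/eqP.
  by apply/eqP; rewrite eqEsubset subsetDl subsetD1 subxx.
have [XP XA] := YB _ (pblock_in Y u) XU'.
rewrite inE XP XA; apply: contra nX => /triv_del; apply.
by apply/set0Pn; exists u; rewrite !inE ui pblock_self.
Qed.

Lemma perm_into (S T : {set 'I_r}) : #|S| <= #|T| ->
  exists f : 'S_r, forall i, i \in S -> f i \in T.
Proof.
move=> ST; pose T' := [set x in take #|S| (enum T)].
have T'T x : x \in T' -> x \in T by rewrite inE => /mem_take; rewrite mem_enum.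
have cT : #|T'| = #|S|.
  rewrite cardsE; have /card_uniqP -> : uniq (take #|S| (enum T)) by rewrite take_uniq ?enum_uniq.
  by rewrite size_takel // -cardE.
have [z|h hinj hE] := @fiber_bij _ _ _ (fun i => i \in S) (fun i => i \in T').
  have eT (R : {set 'I_r}) : #|[pred x | (x \in R) == true]| = #|R|.
    by apply: eq_card => i; rewrite !inE eqb_id.
  have eF (R : {set 'I_r}) : #|[pred x | (x \in R) == false]| = #|~: R|.
    by apply: eq_card => i; rewrite !inE eqbF_neg.
  case: z; rewrite ?eT ?eF ?cT //.
  by apply/eqP; rewrite -(eqn_add2l #|S|) cardsC -cT cardsC.
by exists (perm hinj) => i iS; rewrite permE T'T // hE.
Qed.

End ClosedRight.
End Closure.

(** * Breaking up a nontrivial block *)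

Section Step.
Variables r k : nat.
Local Notation lab := ('I_r -> 'I_k).
Local Notation diag := (diagram r).
Implicit Types (a b d : lab) (P Q D : diag) (S : {set 'I_r}) (A C X : {set vertex r}).
Variable Bel : lab -> lab -> diag -> Prop.
Hypothesis cB : mult_closed Bel.

(* C is broken up into bars and lone bottom vertices, which removes one       *)
(* nontrivial block, and is restored by fusing its bottom vertices. The other *)
(* terms of that product hit a nontrivial block or A (fewer nontrivial        *)
(* blocks), or leave out a lone vertex, or are isomorphic to P.               *)
Lemma split_step N a b P A C : A \in blocks P -> #|nt a b P A| <= N ->
  within Bel (fun x y => x < N) ->
  (forall d P' i, A \in blocks P' -> #|nt a d P' A| <= N ->
     lone P' i -> A != [set inr i] -> Bel a d P') ->
  (forall i, lone P i -> A = [set inr i]) ->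
  C \in nt a b P A -> #|[set i | inl i \in C]| <= #|[set j | inr j \in C]| ->
  Bel a b P.
Proof.
move=> AP ntN IHN hL noL; rewrite inE => /and3P[CP CA nC] ctb.
have [f fct] := perm_into ctb.
pose ct := [set i | inl i \in C]; pose cb := [set j | inr j \in C].
(* The top vertex [i] of [C] is paired with the bottom vertex [f i], and the unpaired bottom
   vertices become lone. The labels [b'] copy the top label to its partner, so that the pairs are
   genuine bars. *)
pose c v := match v with inl i => f i | inr j => j end.
pose D : diag := kerd (fun v => if v \in C then inl (c v) else inr (pblock P v)).
pose b' j := if (j \in cb) && ((f^-1)%g j \in ct) then a ((f^-1)%g j) else b j.
have pbC u : u \in C -> pblock P u = C by apply: pblock_block.
have pD1 u : u \notin C -> pblock D u = pblock P u.
  move=> uC; apply/setP => v; rewrite mem_pblockE same_kerd (negPf uC).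
  case: ifP => vC; last by rewrite (inj_eq inr_inj) mem_pblockE.
  apply/esym/negP => uv; move/negP: uC; apply.
  by rewrite -(pbC _ vC) (pblock_block (pblock_in P u) uv) pblock_self.
have pD2 u : u \in C -> pblock D u = [set v in C | c u == c v].
  move=> uC; apply/setP => v; rewrite mem_pblockE same_kerd uC inE.
  by case: ifP => vC //; rewrite (inj_eq inl_inj).
have fcb i : inl i \in C -> inr (f i) \in C.
  by move=> iC; have := fct i; rewrite !inE; apply.
have triC u : u \in C -> triv a b' (pblock D u).
  move=> uC; rewrite pD2 //; have [cC|cC] := boolP ((f^-1)%g (c u) \in ct).
    apply/trivP; right; exists ((f^-1)%g (c u)), (c u); split; last first.
      by rewrite /b' cC andbT ifT // inE; case: u uC {cC} => u /=; first exact: fcb.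
    have cuC : inr (c u) \in C by case: u uC {cC} => u //=; apply: fcb.
    apply/setP => -[i|j]; rewrite !inE ?orbF /=.
      apply/andP/eqP => [[_ /eqP->]|[->]]; first by rewrite permK.
      by rewrite permKV eqxx; split=> //; rewrite inE in cC.
    by apply/andP/eqP => [[_ /eqP->]|[->]] //; rewrite eqxx.
  apply/trivP; left; exists u; apply/setP => v; rewrite !inE.
  case: u uC cC => u uC; first by rewrite /= permK inE uC.
  rewrite /= => uf; apply/andP/eqP => [[vC]|->]; last by rewrite uC eqxx.
  case: v vC => v vC /eqP uv; last by rewrite uv.
  by move: uf; rewrite uv /= permK inE vC.
have hitC u : hit cb (pblock D u) = (u \in C).
  apply/hitP/idP => [[j]|uC].
    rewrite inE => jC ju; apply: contraLR jC => uC; rewrite pD1 // in ju.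
    apply: contra uC => jC; rewrite -(pbC _ jC) (pblock_block (pblock_in P u) ju).
    exact: pblock_self.
  have cuC : inr (c u) \in C by case: u uC => u //=; apply: fcb.
  by exists (c u); rewrite ?pD2 // !inE ?cuC /= ?eqxx.
have meldE : meld D cb = P.
  apply: diagram_eq => u v; rewrite -!mem_pblockE pblock_meld hitC.
  case: ifP => uC; last by rewrite pD1 ?uC.
  by rewrite inE hitC pbC.
have jAC u : u \in A -> u \notin C.
  by move=> uA; apply: contra CA => uC; rewrite (block_disjoint CP AP uC uA).
have AD : A \in blocks D.
  have [u uA] := set0Pn _ (block_neq0 AP).
  by apply/blockP; exists u; rewrite pD1 ?jAC // (pblock_block AP uA).
have b'E j : j \notin cb -> b' j = b j by rewrite /b' => /negPf ->.
have ntD : nt a b' D A \subset nt a b P A :\ C.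
  apply/subsetP => X; rewrite in_setD1 !inE => /and3P[/blockP[u ->]].
  have [uC|uC] := boolP (u \in C); first by rewrite triC.
  rewrite pD1 // pblock_in => -> nX; have uX := pblock_self P u.
  have -> /= : pblock P u != C by apply: contraNneq uC => <-.
  rewrite (triv_ext a (b := b) (d := b')) // => j jX; apply/esym/b'E.
  rewrite inE; apply: contra uC => jC.
  by rewrite -(pbC _ jC) (pblock_block (pblock_in P u) jX).
have ntDN : #|nt a b' D A| < N.
  apply: leq_ltn_trans (subset_leq_card ntD) _; apply: leq_trans ntN.
  by rewrite [X in _ < X](cardsD1 C) inE CP CA nC.
have loneD i : lone D i -> A != [set inr i] -> i \in cb.
  rewrite inE /lone => li Ai; apply: contraNT Ai => iC; apply/eqP/noL.
  by rewrite /lone -pD1.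
have [j0 j0S] : exists j, j \in cb.
  apply/card_gt0P; have [[i|j] uC] := set0Pn _ (block_neq0 CP).
    by apply: leq_trans ctb; apply/card_gt0P; exists i; rewrite inE.
  by apply/card_gt0P; exists j; rewrite inE.
rewrite -meldE; apply: (closed_fuse cB j0S b'E); first exact: (IHN _ _ _ A).
move=> s b's; set S' := s @^-1: cb; set T := meld D S'.
have bs j : j \notin S' -> b' j = (b \o s) j by rewrite inE => /b'E /= <-; rewrite -[LHS]b's.
have ext X : ~~ hit S' X -> triv a b' X = triv a (b \o s) X.
  move=> hX; apply: triv_ext => j jX; apply: bs; apply: contra hX => jS.
  by apply/hitP; exists j.
(* If [A] is hit, the merged block takes over the mark and no nontrivial block is added to those of
   [D]. *)
have [hA|hA] := boolP (hit S' A).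
  right; have /hitP[j jS _] := hA; apply: (IHN _ _ _ (merged D S')); first exact: merged_in jS.
  apply: leq_ltn_trans ntDN; apply/subset_leq_card/subsetP => X; rewrite !inE.
  case/and3P => /meld_block[->|[XD hX]]; first by rewrite eqxx.
  by rewrite XD ext // => _ ->; rewrite andbT; apply: contraNneq hX => ->.
have AT : A \in blocks T by apply: meld_unhit.
have ntT : nt a (b \o s) T A \subset merged D S' |: nt a b' D A.
  apply/subsetP => X; rewrite !inE => /and3P[/meld_block[->|[XD hX]]]; first by rewrite eqxx.
  by rewrite XD ext // => -> ->; rewrite orbT.
(* If a nontrivial block is hit, it disappears into the merged one, so their number does not
   grow. *)
have [/existsP[X /andP[XN hX]]|nX] := boolP [exists X in nt a b' D A, hit S' X].
  right; apply: (IHN _ _ _ A) => //; apply: leq_ltn_trans ntDN.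
  apply: (@leq_trans #|merged D S' |: (nt a b' D A :\ X)|).
    apply/subset_leq_card/subsetP => Z ZT; have := subsetP ntT _ ZT.
    rewrite !in_setU1 in_setD1; case: eqP => //= ZU ->; rewrite andbT.
    move: ZT; rewrite inE => /and3P[/meld_block[//|[_ hZ]] _ _].
    by apply: contraNneq hZ => ->.
  rewrite cardsU1 [X in _ <= X](cardsD1 X) XN leq_add2r.
  by case: (_ \notin _).
(* A lone vertex that is left out stays lone. The merged block brings the count to at most [N], the
   bound that [hL] allows. *)
have [/existsP[i /and3P[li Ai iS]]|nL] :=
    boolP [exists i, [&& lone D i, A != [set inr i] & i \notin S']].
  right; apply: (hL _ _ i) => //.
    apply: leq_trans (subset_leq_card ntT) _; rewrite cardsU1.
    by apply: leq_trans ntDN; rewrite -add1n leq_add2r; case: (_ \notin _).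
  rewrite /lone pblock_meld ifF //; apply/hitP => -[j jS].
  by rewrite (eqP li) inE => /eqP[ji]; rewrite -ji jS in iS.
(* Now only trivial blocks are hit, and both fused sets contain the same lone vertices: all of them,
   except one that is [A] itself. *)
left; apply: kap_iso; apply: (kap_meld_perm j0S b's b'E) => [j jS|j jS|j lj].
- by apply: triC; rewrite inE in jS.
- have hj : hit S' (pblock D (inr j)) by apply/hitP; exists j => //; apply: pblock_self.
  apply: contraR nX => tj; apply/existsP; exists (pblock D (inr j)).
  by rewrite hj andbT inE pblock_in tj andbT; apply: contraNneq hA => <-.
have [Aj|Aj] := eqVneq A [set inr j].
  have jA : inr j \in A by rewrite Aj inE.
  rewrite inE (negPf (jAC _ jA)); apply/esym/negP => jS.
  by case/negP: hA; apply/hitP; exists j.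
rewrite loneD //; apply/esym; apply: contraR nL => jS.
by apply/existsP; exists j; rewrite lj Aj.
Qed.

End Step.

(** * The double induction *)

Section Induction.
Variables r k : nat.
Local Notation lab := ('I_r -> 'I_k).
Local Notation diag := (diagram r).
Implicit Types (a b d : lab) (P Q D : diag) (S : {set 'I_r}) (A C X : {set vertex r}).

Lemma card_nt_flip a b P A : #|nt b a (flip P) (flipv @: A)| = #|nt a b P A|.
Proof. by rewrite nt_flip card_imset //; apply/imset_inj/inv_inj/flipvK. Qed.

Lemma within_mirror (Bel : lab -> lab -> diag -> Prop) pr :
  within Bel pr -> within (mirror Bel) pr.
Proof.
move=> IH a b P A AP; rewrite -card_nt_flip -(card_imset (mem A) (inv_inj (@flipvK r))).
by apply: IH; rewrite flip_block.
Qed.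

Lemma closed_step N M (Bel : lab -> lab -> diag -> Prop) a b P A :
  mult_closed Bel -> A \in blocks P -> #|nt a b P A| <= N -> #|A| = M ->
  within Bel (fun x y => x < N) -> within Bel (fun x y => x <= N /\ M < y) ->
  Bel a b P.
Proof.
move=> cB AP ntN AM IHN IHM.
have cB' := mirror_closed cB.
have PK : Bel a b P = mirror Bel b a (flip P) by rewrite /mirror flipK.
have AfP : flipv @: A \in blocks (flip P) by rewrite flip_block.
have ntf : #|nt b a (flip P) (flipv @: A)| <= N by rewrite card_nt_flip.
have Af : #|flipv @: A| = M by rewrite (card_imset _ (inv_inj (@flipvK r))).
have hL d P' i : A \in blocks P' -> #|nt a d P' A| <= N ->
    lone P' i -> A != [set inr i] -> Bel a d P'.
  by move=> AP' ntN'; apply: (lone_step cB AP' ntN'); rewrite AM.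
have hT d P' i : flipv @: A \in blocks P' -> #|nt b d P' (flipv @: A)| <= N ->
    lone P' i -> flipv @: A != [set inr i] -> mirror Bel b d P'.
  move=> AP' ntN'; apply: (lone_step cB' AP' ntN'); rewrite Af.
  exact: within_mirror.
have [/existsP[i /andP[li Ai]]|nL] := boolP [exists i, lone P i && (A != [set inr i])].
  exact: hL li Ai.
have noL i : lone P i -> A = [set inr i].
  by move=> li; apply/eqP; apply: contraR nL => Ai; apply/existsP; exists i; rewrite li.
have [/existsP[i /andP[li Ai]]|nT] :=
    boolP [exists i, lone (flip P) i && (flipv @: A != [set inr i])].
  by rewrite PK; apply: hT li Ai.
have noT i : lone (flip P) i -> flipv @: A = [set inr i].
  by move=> li; apply/eqP; apply: contraR nT => Ai; apply/existsP; exists i; rewrite li.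
(* No singleton other than [A] remains in either row, so without nontrivial blocks all blocks but
   [A] are bars. *)
have [n0|[C CN]] := set_0Vmem (nt a b P A).
  apply: (closed_R cB AP) => X XP XA.
  have : X \notin nt a b P A by rewrite n0 inE.
  rewrite inE XP XA negbK => /trivP[[[i|i] Xi]|//]; case/eqP: XA.
    apply: (inv_inj (@flip_imsetK r)); rewrite (noT i) ?Xi ?imset_set1 //.
    by rewrite /lone pblock_flip /= (pblock_block XP) Xi ?inE // imset_set1.
  by rewrite (noL i) // /lone (pblock_block XP) Xi ?inE.
have [cc|/ltnW cc] := leqP #|[set i | inl i \in C]| #|[set j | inr j \in C]|.
  exact: (split_step cB AP ntN IHN hL noL CN).
rewrite PK; apply: (split_step cB' AfP ntf (within_mirror IHN) hT noT (C := flipv @: C)).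
  by rewrite nt_flip; apply/imset_f.
have fE (v : vertex r) : (v \in flipv @: C) = (flipv v \in C).
  by rewrite -{1}[v]flipvK (mem_imset _ _ (inv_inj (@flipvK r))).
under eq_finset => i do rewrite fE /=.
by under [X in _ <= #|pred_of_set X|]eq_finset => i do rewrite fE /=.
Qed.

(** Any block can be marked at the start. The inner induction ends because a block has at most
    [2 * r] vertices. *)
Theorem closed_all (Bel : lab -> lab -> diag -> Prop) a b P : 0 < r -> mult_closed Bel -> Bel a b P.
Proof.
move=> r0 cB; pose A := pblock P (inl (Ordinal r0)).
have AP : A \in blocks P by apply: pblock_in.
have main N : within Bel (fun x y => x < N).
  elim: N => // N IHN a' b' P' A' AP'; rewrite ltnS => ntN.
  have [m] := ubnP (2 * r - #|A'|); elim: m => // m IHm in a' b' P' A' AP' ntN *.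
  rewrite ltnS => Am; apply: (closed_step cB AP' ntN erefl IHN) => a2 b2 P2 A2 AP2 [ntN2 AA].
  apply: IHm AP2 ntN2 _; apply: leq_trans Am; apply: ltn_sub2l => //.
  apply: leq_trans AA _; apply: leq_trans (max_card _) _.
  by rewrite card_sum !card_ord mul2n addnn.
exact: (main _ _ _ _ A AP (ltnSn _)).
Qed.

End Induction.

(** * Return to the algebra *)

Section Generation.
Variables (K : numFieldType) (r k n : nat) (r_gt0 : 0 < r) (k_gt0 : 0 < k).
Local Open Scope ring_scope.

Lemma Theta_mult_closed (B : {pred MP K r n k_gt0}) :
  GRing.subalg_closed B -> (forall x, Theta r_gt0 x -> x \in B) ->
  mult_closed (fun a b P => el K n k_gt0 a b P \in B).
Proof.
move=> [B1 Bl BM] BT.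
have B0 : 0 \in B by have := Bl (-1) _ _ B1 B1; rewrite scaleN1r addNr.
have BD u v : u \in B -> v \in B -> u + v \in B by move=> uB vB; rewrite -[u]scale1r Bl.
have BZ c u : u \in B -> c *: u \in B by move=> uB; rewrite -[_ *: _]addr0 Bl.
split=> [a b P a' b' Q /el_iso -> //|a b P C CP hP|b i|a b d P Q D aP bQ [nb0 PQ] hs].
- exact/BT/(R_el _ _ _ _ CP).
- exact/BT/P_el.
pose Z s := relab (conj_srt b s) 1%g Q.
(* All permutations whose term is exactly [el a d D] are gathered, since several may contribute
   it. *)
pose lead s := `[< nb_middle P (Z s) = 0%N /\ iso a d (compose P (Z s)) a d D >].
have lead1 : lead 1%g.
  apply/asboolP; rewrite /Z /conj_srt invg1 mul1g mulVg relab1 nb0 PQ.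
  by split=> //; apply: iso_refl.
have := el_mul K n k_gt0 a b d P Q; rewrite (bigID lead) /=.
rewrite (eq_bigr (fun=> el K n k_gt0 a d D)) => [|s /andP[_ /asboolP[-> /el_iso ->]]]; last first.
  by rewrite expr0 scale1r.
rewrite sumr_const -scaler_nat; set c := #|_|; set rest := \sum_(_ | _) _ => e.
have restB : rest \in B.
  apply: (big_ind (fun u => u \in B)) => // s /andP[sy nl]; apply: BZ.
  case: (hs _ (conj_srtE sy)) => [h|//].
  by case/negP: nl; apply/asboolP.
(* The identity is a leading permutation, so [c] is a positive integer and can be inverted in a
   numeric field. *)
have c0 : c%:R != 0 :> K.
  rewrite pnatr_eq0 -lt0n; apply/card_gt0P; exists 1%g.
  by rewrite -topredE /= group1.
rewrite -[el _ _ _ _ _ _](scalerK c0); apply: (BZ _ _).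

have -> : c%:R *: el K n k_gt0 a d D =
    (-1) *: rest + #|young (wt b)|%:R *: (el K n k_gt0 a b P * el K n k_gt0 b d Q).
  by rewrite e scaleN1r addrCA addNr addr0.
exact: Bl restB (BZ _ _ (BM _ _ aP bQ)).
Qed.

Lemma Theta_generates : generates (Theta (K := K) (n := n) r_gt0 (k_gt0 := k_gt0)).
Proof.
move=> B Bsub BT; apply: el_span => [|a b P].
  by have [B1 Bl _] := Bsub; split=> //; have := Bl (-1) _ _ B1 B1; rewrite scaleN1r addNr.
exact: closed_all r_gt0 (Theta_mult_closed Bsub BT).
Qed.

End Generation.

From mathcomp Require Import reals complex.

Theorem theorem7p11 (R : realType) (r k n : nat)
    (r_gt0 : (0 < r)%N) (k_gt0 : (0 < k)%N) (n_ge : (2 * r <= n)%N) :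
  generates (Theta (K := complex R) (n := n) r_gt0 (k_gt0 := k_gt0)).
Proof. exact: Theta_generates. Qed.
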